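(* Let $n\ge 1$ and let $(W_n,S_n)$ be a Coxeter system of type $B_n$ (with $B_1=A_1$). Then the Loewy length of the Solomon descent algebra $\Sigma(W_n)$ is equal to $\left\lceil\frac{n}{2}\right\rceil$.
   Context: Let $(W,S)$ be a finite Coxeter system with length function $\ell$. For $I\subset S$, set $X_I=\{w\in W : \ell(ws)>\ell(w)\ \text{for all } s\in I\}$ and $x_I=\sum_{w\in X_I} w\in\mathbb{Q}W$. The Solomon descent algebra is $\Sigma(W)=\bigoplus_{I\subset S}\mathbb{Q}x_I$; it is a unital subalgebra of the group algebra $\mathbb{Q}W$, with basis $(x_I)_{I\subset S}$ (Solomon). The Loewy length of a finite dimensional algebra $A$ is the smallest integer $k\ge 1$ such that $(\mathrm{Rad}\,A)^k=0$, where $\mathrm{Rad}\,A$ is the (Jacobson) radical. *)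

(* Defs.v *)
From HB Require Import structures.
From mathcomp Require Import all_boot all_order all_fingroup all_algebra all_field.
From mathcomp Require Import boolp.

Set Implicit Arguments.
Unset Strict Implicit.
Unset Printing Implicit Defensive.

Import GRing.Theory.
Local Open Scope ring_scope.

(* Junk value 0 when P is empty. *)
Definition least (P : pred nat) : nat :=
  if pselect (exists n, P n) is left exP then ex_minn exP else 0%N.

Section GroupAlgebra.
Variables (F : fieldType) (gT : finGroupType).

(* The alias hides the pointwise product that {ffun gT -> F} already carries. *)
Definition group_alg : Type := {ffun gT -> F^o}.

HB.instance Definition _ := Vector.on group_alg.

Implicit Types a b c : group_alg.

Definition galg_elt (g : gT) : group_alg := [ffun h => (h == g)%:R].

Definition galg_mul a b : group_alg :=
  [ffun g => \sum_(h : gT) (a h : F) * b (h^-1 * g)%g].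

Fact galg_mulA : associative galg_mul.
Proof.
move=> a b c; apply/ffunP => g; rewrite !ffunE.
under [RHS]eq_bigr do rewrite ffunE mulr_suml.
rewrite exchange_big /=; apply: eq_bigr => h _.
rewrite ffunE mulr_sumr (reindex_inj (mulgI h^-1%g)) /=.
by apply: eq_bigr => k _; rewrite mulrA invMg invgK -mulgA mulKVg.
Qed.

Fact galg_mul1l : left_id (galg_elt 1) galg_mul.
Proof.
move=> a; apply/ffunP => g; rewrite ffunE (bigD1 1%g) //= ffunE eqxx mul1r.
rewrite invg1 mul1g big1 ?addr0 // => h /negbTE h1.
by rewrite ffunE h1 mul0r.
Qed.

Fact galg_mul1r : right_id (galg_elt 1) galg_mul.
Proof.
move=> a; apply/ffunP => g; rewrite ffunE (bigD1 g) //= ffunE mulVg eqxx mulr1.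
rewrite big1 ?addr0 // => h hg; rewrite ffunE -eq_mulVg1.
by rewrite (negbTE hg) mulr0.
Qed.

Fact galg_mulDl : left_distributive galg_mul +%R.
Proof.
move=> a b c; apply/ffunP => g; rewrite !ffunE -big_split /=.
by apply: eq_bigr => h _; rewrite ffunE mulrDl.
Qed.

Fact galg_mulDr : right_distributive galg_mul +%R.
Proof.
move=> a b c; apply/ffunP => g; rewrite !ffunE -big_split /=.
by apply: eq_bigr => h _; rewrite ffunE mulrDr.
Qed.

Fact galg_elt1_neq0 : galg_elt 1 != 0.
Proof.
by apply/eqP => /ffunP/(_ 1%g)/eqP; rewrite !ffunE eqxx oner_eq0.
Qed.

HB.instance Definition _ := GRing.Zmodule_isNzRing.Build group_alg
  galg_mulA galg_mul1l galg_mul1r galg_mulDl galg_mulDr galg_elt1_neq0.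

Fact galg_scaleAl (k : F) a b : k *: (a * b) = (k *: a) * b.
Proof.
apply/ffunP => g; rewrite !ffunE scaler_sumr.
by apply: eq_bigr => h _; rewrite ffunE; exact: mulrA.
Qed.

HB.instance Definition _ :=
  GRing.Lmodule_isLalgebra.Build F group_alg galg_scaleAl.

Fact galg_scaleAr (k : F) a b : k *: (a * b) = a * (k *: b).
Proof.
apply/ffunP => g; rewrite !ffunE scaler_sumr.
by apply: eq_bigr => h _; rewrite ffunE; exact: mulrCA.
Qed.

HB.instance Definition _ :=
  GRing.Lalgebra_isAlgebra.Build F group_alg galg_scaleAr.
HB.instance Definition _ := Algebra_isFalgebra.Build F group_alg.

Lemma galg_eltM (g h : gT) : galg_elt (g * h) = galg_elt g * galg_elt h.
Proof.
apply/ffunP => k; rewrite !ffunE (bigD1 g) //= !ffunE eqxx mul1r.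
rewrite big1 ?addr0 => [|x /negbTE xg]; last by rewrite ffunE xg mul0r.
by congr (nat_of_bool _)%:R; rewrite -(inj_eq (mulgI g^-1%g)) mulKg.
Qed.

End GroupAlgebra.

Section JacobsonRadical.
Variables (F : fieldType) (aT : falgType F).
Implicit Types A L M : {vspace aT}.

Fact bigcap_vspace_ex (P : {vspace aT} -> Prop) :
  exists U : {vspace aT}, forall x, x \in U <-> forall V, P V -> x \in V.
Proof.
pose Q d := `[< exists U : {vspace aT},
  \dim U = d /\ forall x, (forall V, P V -> x \in V) -> x \in U >].
have exQ : exists d, Q d.
  by exists (\dim {: aT}); apply/asboolP; exists fullv; split=> // x _; rewrite memvf.
case: (ex_minnP exQ) => d /asboolP[U [dimU subU]] minU.
exists U => x; split=> [xU V PV | ]; last exact: subU.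
suff sUV : (U <= V)%VS by exact: (subvP sUV).
apply/capv_idPl/eqP; rewrite eqEdim capvSl dimU /=; apply: minU.
by apply/asboolP; exists (U :&: V)%VS; split=> // y Hy; rewrite memv_cap subU ?Hy.
Qed.

(* Intersection of an arbitrary family of subspaces. *)
Definition bigcap_vspace (P : {vspace aT} -> Prop) : {vspace aT} :=
  projT1 (cid (bigcap_vspace_ex P)).

Lemma memv_bigcap_vspace (P : {vspace aT} -> Prop) x :
  x \in bigcap_vspace P <-> forall V, P V -> x \in V.
Proof. by rewrite /bigcap_vspace; case: cid. Qed.

(* In what follows A is meant to be a unital subalgebra of aT, so that its left
   ideals are subspaces. *)
Definition left_ideal A L : bool := (L <= A)%VS && (A * L <= L)%VS.

Definition maximal_left_ideal A M : Prop :=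
  [/\ left_ideal A M, M != A &
      forall L, left_ideal A L -> (M <= L)%VS -> L = M \/ L = A].

Definition jacobson_radical A : {vspace aT} :=
  (A :&: bigcap_vspace (maximal_left_ideal A))%VS.

(* The power of a subspace is the span of the products of its elements. *)
Definition loewy_length A : nat :=
  least (fun k => (0 < k)%N && (jacobson_radical A ^+ k == 0)%VS).

End JacobsonRadical.

Section Coxeter.
Variable gT : finGroupType.
Implicit Types (S I : {set gT}) (w : gT).

(* gT is the group presented by the generators S and the relations
   (s * t) ^+ m(s, t) = 1, where m(s, t) = #[s * t]; the relations with s = t
   say that generators are involutions. The presentation is expressed by its
   universal property among all, possibly infinite, groups. *)
Definition coxeter_system S : Prop :=
  [/\ <<S>>%g = [set: gT],
      forall s, s \in S -> #[s]%g = 2%N &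
      forall (H : groupType) (f : gT -> H),
        (forall s t, s \in S -> t \in S -> ((f s * f t) ^+ #[(s * t)%g] = 1)%g) ->
        exists2 phi : gT -> H,
          {morph phi : x y / (x * y)%g} & {in S, phi =1 f}].

(* Diagram of type B_n on the nodes 0, ..., n - 1, the multiple edge joining
   0 and 1. *)
Definition coxeter_matrix_B (i j : nat) : nat :=
  (if i == j then 1
   else if (i.+1 == j) || (j.+1 == i)
     then if (i == 0) || (j == 0) then 4 else 3
   else 2)%N.

Definition type_B (n : nat) S : Prop :=
  exists s : 'I_n -> gT,
    [/\ injective s, S = [set s i | i : 'I_n] &
        forall i j, #[(s i * s j)%g]%g = coxeter_matrix_B i j].

(* (S ^+ k)%g is the set of products of k elements of S. *)
Definition cox_length S w : nat := least (fun k => w \in (S ^+ k)%g).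

Definition descX S I : {set gT} :=
  [set w | [forall s in I, cox_length S w < cox_length S (w * s)%g]%N].

Definition descx S I : group_alg rat gT :=
  \sum_(w in descX S I) galg_elt rat w.

Definition descent_algebra S : {vspace group_alg rat gT} :=
  (\sum_(I in powerset S) <[descx S I]>)%VS.

End Coxeter.

(* Main.v *)
From HB Require Import structures.
Require Import Defs.
From mathcomp Require Import all_boot all_order all_fingroup all_algebra all_field.
From mathcomp Require Import boolp ring lra zify.

(** The descent algebra is read off the faces of the reflection arrangement
    (Bidigare). A point [v] of Q^n is extended to signed indices by
    [v_(-k) = - v_k], and its face records which pairs of signed indices satisfy
    [v_x < v_y]: this is the sign vector of [v] for the arrangement of type B.
    The product [face_mul F G] breaks the ties of [F] by means of [G]; it is the
    face reached from [F] by a small step towards [G]. The group acts on faces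
    and permutes the chambers simply transitively. Letting invariant combinations
    of faces act on chambers gives an injective, product-reversing map [Psi] to
    the group algebra, and the orbit of the standard face of type [I] goes to a
    multiple of [x_I]; hence the image is the descent algebra
    ([descent_algebraP]).

    The radical. A face [F] lies in the flat of [K] iff [K F = K], so summing
    coefficients over these [F] is a character [chi K]. The radical is the common
    kernel of the [chi K] ([descent_radical]): it is cut out by characters to Q,
    and it is nilpotent by the following dimension count. If [a] is in the kernel
    and [G] is a face, the terms of [G a] in the flat of [G] cancel. Moreover a flat
    one dimension larger is divided by the flat of [G] into two sides; [-1] is in
    the group and exchanges them, so the two terms of [G a] there have equal
    coefficients, and the sum of these is a difference of two values of characters
    ([two_sides], [rank_step]). Each factor thus raises the rank by two, and the
    [k]-th power of the radical lives in rank at least [2 k]. If [2 k >= n], only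
    multiples of the sum of all chambers could remain, and the character of the
    whole space excludes them ([radical_exp0]).

    Non-vanishing. The faces with [p] singletons followed by a block of size
    [n - p], and those with the block first, span the same flats, so the
    difference [block_diff p] of the two orbit sums is in the radical. The product of
    [block_diff 1], [block_diff 3], ... is not zero: in the coefficient of the
    face with [p] singletons followed by the block, only one chain of
    intermediate faces contributes ([block_face_unique]), and each link of the
    chain contributes a nonzero factor, because two singletons precede the block
    more often when the block is outermost than when it is innermost
    ([block_inner_gt0]).

    The action on points is obtained from the presentation of the group, and the
    length enters only through the fact that [w s_i] is longer than [w] iff [w]
    sends the [i]-th simple root to a positive one ([length_lt_pos]), which is
    proved by rank two computations with the Cartan matrix. *)

Set Implicit Arguments.
Unset Strict Implicit.
Unset Printing Implicit Defensive.
Import Order.TTheory GRing.Theory Num.Theory.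
Local Open Scope ring_scope.


(** * Subspaces cut out by predicates, and the radical *)

Section LinearPredicates.
Variables (F : fieldType) (vT : vectType F) (P : vT -> Prop).

Definition lin_closed := P 0 /\ forall k u v, P u -> P v -> P (k *: u + v).

(** A subspace of maximal dimension among those on which [P] holds contains
    every solution of [P], as it could otherwise be enlarged by a line. *)
Lemma lin_closed_vspace :
  lin_closed -> exists U : {vspace vT}, forall x, x \in U <-> P x.
Proof.
move=> [P0 PD].
pose Q d := `[< exists U : {vspace vT}, \dim U = d /\ forall x, x \in U -> P x >].
have exQ : exists d, Q d.
  exists 0%N; apply/asboolP; exists 0%VS; split; first by rewrite dimv0.
  by move=> x; rewrite memv0 => /eqP->.
have ubQ d : Q d -> (d <= \dim {:vT})%N.
  by move=> /asboolP[U [<- _]]; rewrite dimvS ?subvf.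
case: (ex_maxnP exQ ubQ) => d /asboolP[U [dU UP]] maxd.
exists U => x; split=> [/UP//|Px]; apply: contraT => xU.
have: Q (\dim (U + <[x]>)%VS).
  apply/asboolP; exists (U + <[x]>)%VS; split=> // y.
  move=> /memv_addP[u uU [v /vlineP[k ->] ->]].
  by rewrite addrC; apply: PD => //; exact: UP.
move=> /maxd; rewrite -dU => led.
have /eqP eU : U == (U + <[x]>)%VS by rewrite eqEdim addvSl led.
by move: xU; rewrite eU -{1}[x]add0r memv_add ?mem0v ?memv_line.
Qed.

Definition vspace_of (lP : lin_closed) : {vspace vT} :=
  projT1 (cid (lin_closed_vspace lP)).

Lemma memv_of (lP : lin_closed) x : x \in vspace_of lP <-> P x.
Proof. by rewrite /vspace_of; case: cid. Qed.

End LinearPredicates.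

Section Radical.
Variables (F : fieldType) (aT : falgType F) (A N : {vspace aT}).
Hypotheses (A1 : 1 \in A) (sNA : (N <= A)%VS) (ANN : (A * N <= N)%VS).
Hypothesis nilN : forall x, x \in N -> exists k, x ^+ k = 0.
Hypothesis sepN : forall x, x \in A -> x \notin N ->
  exists2 M, maximal_left_ideal A M & x \notin M.

(** If [N] is not contained in [M], then [M + N = A] gives [m = 1 - y] in [M]
    with [y] nilpotent, and the geometric series inverts [m]. *)
Lemma nil_ideal_sub_maximal M : maximal_left_ideal A M -> (N <= M)%VS.
Proof.
move=> [/andP[sMA AMM] neMA maxM]; apply/subvP => x xN.
have lMN : left_ideal A (M + N).
  rewrite /left_ideal subv_add sMA sNA /= prodvDr.
  by rewrite addvS.
case: (maxM _ lMN (addvSl _ _)) => [<-|eMN].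
  by rewrite -[x]add0r memv_add ?mem0v.
have := A1; rewrite -eMN => /memv_addP[m mM [y yN e1]].
have [k yk] := nilN yN.
have em : m = 1 - y by rewrite e1 addrK.
have sAi i : y ^+ i \in A.
  case: i => [|i]; first by rewrite expr0.
  elim: i => [|i IH]; first by rewrite expr1 (subvP sNA).
  rewrite exprSr; apply/(subvP sNA)/(subvP ANN).
  by rewrite memv_mul.
have M1 : 1 \in M.
  have -> : 1 = (\sum_(i < k) y ^+ i) * m.
    have := subrX1 y k; rewrite yk sub0r => e.
    have /eqP := e; rewrite eqr_oppLR => /eqP ->; rewrite -mulNr opprB em.
    rewrite mulr_sumr mulr_suml; apply: eq_bigr => i _.
    by rewrite mulrBl mulrBr mul1r mulr1 -exprS -exprSr.
  apply: (subvP AMM); rewrite memv_mul //.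
  by apply: memv_suml => i _.
case/eqP: neMA; apply/eqP; rewrite eqEsubv sMA; apply/subvP => z zA.
by rewrite -[z]mulr1; apply: (subvP AMM); rewrite memv_mul.
Qed.

Lemma jacobson_radicalP : jacobson_radical A = N.
Proof.
apply/eqP; rewrite eqEsubv; apply/andP; split; apply/subvP => x.
  rewrite memv_cap => /andP[xA /memv_bigcap_vspace xM].
  apply: contraT => /(sepN xA)[M mM]; by rewrite xM.
move=> xN; rewrite memv_cap (subvP sNA) //=.
apply/memv_bigcap_vspace => M mM; exact: (subvP (nil_ideal_sub_maximal mM)).
Qed.

End Radical.

Lemma leastE (P : pred nat) k :
  P k -> (forall j, P j -> (k <= j)%N) -> least P = k.
Proof.
move=> Pk minP; rewrite /least; case: pselect => [ex|[]]; last by exists k.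
case: ex_minnP => m Pm minm; apply/eqP; rewrite eqn_leq minm //=; exact: minP.
Qed.

(** * The semigroup of faces and its characters *)

Section SignMonoid.
Variable T : finType.
Implicit Types (F G H K : {set T * T}).

Definition swap (p : T * T) : T * T := (p.2, p.1).

Lemma swapK : involutive swap. Proof. by case. Qed.

(** On sign vectors this is the componentwise product in which the left factor
    takes priority: [p] and [swap p] carry the two signs of one coordinate. *)
Definition face_mul F G : {set T * T} :=
  [set p | (p \in F) || ((swap p \notin F) && (p \in G))].

Definition face_opp F : {set T * T} := [set p | swap p \in F].

Lemma face_mulA : associative face_mul.
Proof.
move=> F G H; apply/setP => p; rewrite !inE swapK.
by do ![case: (_ \in _) => //=].
Qed.

Lemma face_mul0 F : face_mul set0 F = F.
Proof. by apply/setP => p; rewrite !inE. Qed.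

Lemma face_mulF0 F : face_mul F set0 = F.
Proof. by apply/setP => p; rewrite !inE andbF orbF. Qed.

Lemma face_mul_idK F : face_mul F F = F.
Proof. by apply/setP => p; rewrite !inE; case: (p \in F); rewrite ?andbF. Qed.

(** This is the identity [x y x = x y] of a left regular band. *)
Lemma face_mul_absorb F G : face_mul (face_mul F G) F = face_mul F G.
Proof. by apply/setP => p; rewrite !inE; do ![case: (_ \in _) => //=]. Qed.

(** Multiplicativity of the characters [chi K] rests on this equivalence; the
    direct implication uses the left regular band identity. *)
Lemma face_mul_fix K F G :
  (face_mul K (face_mul F G) == K) = (face_mul K F == K) && (face_mul K G == K).
Proof.
apply/eqP/andP => [e|[/eqP eF /eqP eG]]; last by rewrite face_mulA eF eG.
have eF : face_mul K F = K.
  by rewrite -{2}e -(face_mul_absorb F G) !face_mulA -(face_mulA K) e.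
by rewrite eF eqxx -{1}eF -face_mulA e eqxx.
Qed.

Lemma face_mul_fixP K F :
  reflect (forall p, p \notin K -> swap p \notin K -> p \notin F)
          (face_mul K F == K).
Proof.
apply: (iffP eqP) => [e p pK sK|h].
  by apply: contra pK => pF; rewrite -e inE sK pF orbT.
apply/setP => p; rewrite inE; case pK: (p \in K) => //=.
apply/negbTE; case sK: (swap p \in K) => //=; apply: h; by rewrite ?pK ?sK.
Qed.

(** Formal combinations of faces, with the convolution product of the
    semigroup algebra. *)
Definition coefs := {set T * T} -> rat.
Implicit Types a b : coefs.

Definition conv b a : coefs :=
  fun H => \sum_G \sum_(F | face_mul G F == H) b G * a F.

Lemma sum_conv (f : coefs) b a :
  \sum_H f H * conv b a H = \sum_G \sum_F f (face_mul G F) * (b G * a F).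
Proof.
under eq_bigr => H _ do rewrite /conv mulr_sumr.
rewrite exchange_big /=; apply: eq_bigr => G _.
under eq_bigr => H _ do rewrite mulr_sumr.
rewrite (exchange_big_dep predT) //=; apply: eq_bigr => F _.
by rewrite (big_pred1 (face_mul G F)) // => H; rewrite eq_sym.
Qed.

Definition one_coefs : coefs := fun F => (F == set0)%:R.

Lemma conv1 a : conv one_coefs a = a.
Proof.
apply/funext => H; rewrite /conv (bigD1 set0) //= [X in _ + X]big1 ?addr0; last first.
  by move=> G /negbTE G0; apply: big1 => F _; rewrite /one_coefs G0 mul0r.
rewrite (big_pred1 H) => [|F]; first by rewrite /one_coefs eqxx mul1r.
by rewrite face_mul0.
Qed.

(** [face_mul K F == K] says that [F] lies in the flat spanned by [K]. *)
Definition chi K a : rat := \sum_F (face_mul K F == K)%:R * a F.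

Lemma chi_conv K b a : chi K (conv b a) = chi K b * chi K a.
Proof.
rewrite /chi sum_conv mulr_suml; apply: eq_bigr => G _.
rewrite mulr_sumr; apply: eq_bigr => F _.
by rewrite face_mul_fix -mulnb natrM; ring.
Qed.

Lemma chi1 K : chi K one_coefs = 1.
Proof.
rewrite /chi (bigD1 set0) //= face_mulF0 /one_coefs !eqxx mul1r big1 ?addr0 //.
by move=> F /negbTE ->; rewrite mulr0.
Qed.

Definition lincomb k a b : coefs := fun F => k * a F + b F.

Lemma chi_lincomb K k a b : chi K (lincomb k a b) = k * chi K a + chi K b.
Proof.
rewrite /chi mulr_sumr -big_split /=; apply: eq_bigr => F _.
by rewrite /lincomb; ring.
Qed.

End SignMonoid.

Notation signed_index n := ('I_n * bool)%type.

Section Points.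
Variable n : nat.
Local Notation sidx := (signed_index n).
Definition neg (x : sidx) : sidx := (x.1, ~~ x.2).
Local Notation pt := 'rV[rat]_n.
Implicit Types (u v : pt) (x y : sidx).

Definition ext v x : rat := (-1) ^+ x.2 * v 0 x.1.

Lemma ext_neg v x : ext v (neg x) = - ext v x.
Proof. by rewrite /ext /=; case: x.2 => /=; rewrite ?expr0 ?expr1; ring. Qed.

Lemma ext_lin k u v x : ext (k *: u + v) x = k * ext u x + ext v x.
Proof. by rewrite /ext !mxE; ring. Qed.

Lemma ext_opp v x : ext (- v) x = - ext v x.
Proof. by rewrite /ext !mxE; ring. Qed.

Lemma ext0 x : ext 0 x = 0. Proof. by rewrite /ext mxE mulr0. Qed.

Lemma ext_inj u v : ext u =1 ext v -> u = v.
Proof.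
move=> e; apply/rowP => i; have := e (i, false).
by rewrite /ext /= !expr0 !mul1r.
Qed.

Definition face_of v : {set sidx * sidx} := [set p | ext v p.1 < ext v p.2].

Lemma in_face_of v x y : ((x, y) \in face_of v) = (ext v x < ext v y).
Proof. by rewrite inE. Qed.

Lemma face_of0 : face_of 0 = set0.
Proof. by apply/setP => p; rewrite !inE !ext0 ltxx. Qed.

Lemma face_of_opp v : face_of (- v) = face_opp (face_of v).
Proof. by apply/setP => -[x y]; rewrite !inE /= !ext_opp ltrN2. Qed.

Lemma in_face_mul_face_of v F x y : ((x, y) \in face_mul (face_of v) F) =
  (ext v x < ext v y) || ((ext v x == ext v y) && ((x, y) \in F)).
Proof. by rewrite inE /swap /= !in_face_of; case: ltgtP. Qed.

Definition is_face (F : {set sidx * sidx}) := exists v, F = face_of v.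

(** The product is the face of [M v + u] for [M] large: a strict inequality for
    [v] then prevails over any contribution of [u]. *)
Lemma is_face_mul F G : is_face F -> is_face G -> is_face (face_mul F G).
Proof.
move=> [v ->] [u ->].
pose d (w : pt) (p : sidx * sidx) := ext w p.2 - ext w p.1.
pose M := 1 + \sum_p `|d u p| / `|d v p|.
exists (M *: v + u); apply/setP => -[x y].
rewrite in_face_mul_face_of !in_face_of !ext_lin.
have hM a b : ext v a < ext v b -> M * ext v a + ext u a < M * ext v b + ext u b.
  move=> ab; have dv : 0 < `|d v (a, b)| by rewrite normr_gt0 /d /= subr_eq0 gt_eqF.
  have : `|d u (a, b)| / `|d v (a, b)| < M.
    rewrite /M (bigD1 (a, b)) //= addrCA ltrDl ltr_pwDl //.
    by apply: sumr_ge0 => p _; rewrite divr_ge0.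
  rewrite ltr_pdivrMr //.
  have -> : `|d v (a, b)| = ext v b - ext v a.
    by rewrite /d /= ger0_norm // subr_ge0 ltW.
  have := ler_norm (- d u (a, b)); rewrite normrN /d /=; lra.
case: (ltgtP (ext v x) (ext v y)) => [h|h|->] /=.
- by rewrite hM.
- by apply/esym/negbTE; rewrite -leNgt ltW // hM.
- by rewrite ltrD2l.
Qed.

Lemma face0 : is_face set0. Proof. by exists 0; rewrite face_of0. Qed.

Lemma face_mul_fix_face_of v u : (face_mul (face_of v) (face_of u) == face_of v) =
  [forall x, forall y, (ext v x == ext v y) ==> (ext u x == ext u y)].
Proof.
apply/face_mul_fixP/forallP => [h x|h [x y]].
  apply/forallP => y; apply/implyP => /eqP e.
  have := h (x, y); have := h (y, x).
  rewrite /swap /= !in_face_of e ltxx => /(_ isT isT) h1 /(_ isT isT) h2.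
  by rewrite eq_le !leNgt h1 h2.
rewrite /swap !in_face_of /= -!leNgt => h1 h2.
have := forallP (h x) y; rewrite eq_le h1 h2 /= => /eqP ->; exact: lexx.
Qed.

(** The linear span of the face: the points satisfying all the equalities that
    hold on it. *)
Definition face_supp_pred (F : {set sidx * sidx}) u :=
  forall x y, (x, y) \notin F -> (y, x) \notin F -> ext u x = ext u y.

Lemma face_supp_lin F : lin_closed (face_supp_pred F).
Proof.
split=> [x y _ _|k u v hu hv x y h1 h2]; first by rewrite !ext0.
by rewrite !ext_lin (hu x y) // (hv x y).
Qed.

Definition face_supp F : {vspace pt} := vspace_of (face_supp_lin F).

Definition face_rank F := \dim (face_supp F).

Lemma face_supp_face_of v u : u \in face_supp (face_of v) <->
  forall x y, ext v x = ext v y -> ext u x = ext u y.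
Proof.
rewrite memv_of; split=> h x y.
  by move=> e; apply: h; rewrite in_face_of e ltxx.
by rewrite !in_face_of => h1 h2; apply: h; apply/eqP; rewrite eq_le !leNgt h1 h2.
Qed.

Lemma face_supp_self v : v \in face_supp (face_of v). Proof. by apply/face_supp_face_of. Qed.

Lemma face_supp_le v u : (forall x y, ext v x = ext v y -> ext u x = ext u y) ->
  (face_supp (face_of u) <= face_supp (face_of v))%VS.
Proof.
by move=> h; apply/subvP => z /face_supp_face_of hz; apply/face_supp_face_of => x y /h /hz.
Qed.

End Points.

(** * Simple reflections of type B *)

Section Reflections.
Variable n : nat.
Local Notation pt := 'rV[rat]_n.
Local Notation sidx := (signed_index n).
Implicit Types (u v : pt) (x y : sidx) (i j k : 'I_n).

Definition opred i : 'I_n := Ordinal (leq_ltn_trans (leq_pred i) (ltn_ord i)).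
(** The simple root [i] is the coordinate at [root_head i] minus the one at
    [root_tail i]; for [i = 0] this is twice the coordinate [0]. *)
Definition root_head i : sidx := (i, false).
Definition root_tail i : sidx := if i == 0%N :> nat then (i, true) else (opred i, false).

Definition simple_root v i : rat := ext v (root_head i) - ext v (root_tail i).

Lemma simple_root_lin c u v i : simple_root (c *: u + v) i = c * simple_root u i + simple_root v i.
Proof. by rewrite /simple_root !ext_lin; ring. Qed.

Lemma simple_rootE v i :
  simple_root v i = v 0 i + (if i == 0%N :> nat then v 0 i else - v 0 (opred i)).
Proof.
rewrite /simple_root /root_tail /ext /root_head /=.
by case: ifP => /= _; rewrite ?expr0 ?expr1; ring.
Qed.

(** The opposite of the [j]-th simple coroot, so that reflections are written
    with a plus sign. *)
Definition minus_coroot j : pt :=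
  (if j == 0%N :> nat then 0 else delta_mx 0 (opred j)) - delta_mx 0 j.

Lemma minus_corootE j k : minus_coroot j 0 k =
  (if j == 0%N :> nat then 0 else (k == j.-1 :> nat)%:R) - (k == j :> nat)%:R.
Proof.
rewrite /minus_coroot !mxE -!val_eqE /=; case: ifP => _; by rewrite ?mxE ?eqxx -?val_eqE.
Qed.

Definition cartan i j := simple_root (minus_coroot j) i.

Lemma cartanE i j : cartan i j =
  if i == j then -2 else
  if (j == i.+1 :> nat) || (i == j.+1 :> nat) then
    if i == 0%N :> nat then 2 else 1 else 0.
Proof.
rewrite /cartan simple_rootE !minus_corootE -val_eqE /=.
move: (nat_of_ord i) (nat_of_ord j) => a b.
by repeat (case: (@eqP nat _ _) => /= ?); first [exfalso; lia | ring].
Qed.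

Lemma cartan_ii i : cartan i i = -2. Proof. by rewrite cartanE eqxx. Qed.

Lemma cartan_ge0 i j : i != j -> 0 <= cartan i j.
Proof. by rewrite cartanE => /negbTE ->; do ![case: ifP => _]. Qed.

Definition reflect_pt v j : pt := simple_root v j *: minus_coroot j + v.

Lemma reflect_ptE v j k : reflect_pt v j 0 k = simple_root v j * minus_coroot j 0 k + v 0 k.
Proof. by rewrite mxE; congr (_ + _); rewrite mxE. Qed.

Lemma simple_root_reflect v i j :
  simple_root (reflect_pt v j) i = simple_root v i + simple_root v j * cartan i j.
Proof. by rewrite /reflect_pt simple_root_lin addrC. Qed.

Definition reflect_index j x : sidx :=
  if j == 0%N :> nat then (x.1, x.2 (+) (x.1 == j)) else (tperm j (opred j) x.1, x.2).

Lemma reflect_indexK j : involutive (reflect_index j).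
Proof.
move=> [k b]; rewrite /reflect_index; case: (j == 0%N :> nat) => /=; last by rewrite tpermK.
by rewrite -addbA addbb addbF.
Qed.

Lemma reflect_index_neg j x : reflect_index j (neg x) = neg (reflect_index j x).
Proof. by rewrite /reflect_index /neg; case: ifP => _ //=; rewrite addNb. Qed.

Lemma ext_reflect v j x : ext (reflect_pt v j) x = ext v (reflect_index j x).
Proof.
case: x => k b; rewrite /reflect_index /ext reflect_ptE minus_corootE simple_rootE /=.
case: ifP => [j0|j0] /=.
  case: (k =P j) => [->|kj].
    by rewrite eqxx (addbC b) /=; case: b; rewrite /= ?expr0 ?expr1; ring.
  by rewrite addbF (introF (@eqP nat _ _)) => [|/val_inj//] /=; ring.
case: tpermP => [->|->|].
- rewrite eqxx; case: (@eqP nat _ _) => /= e; [exfalso; lia|ring].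
- rewrite /= eqxx; case: (@eqP nat _ _) => /= e; [exfalso; lia|ring].
move=> h1 h2; do 2 case: (@eqP nat _ _) => /= [?|_].
- by exfalso; lia.
- by case: h2; apply: val_inj.
- by case: h1; apply: val_inj.
- by ring.
Qed.

Lemma reflect_ptK v j : reflect_pt (reflect_pt v j) j = v.
Proof. by apply: ext_inj => x; rewrite !ext_reflect reflect_indexK. Qed.

(** In rank two the orbit of [v] stays in [v] plus the span of two coroots, so
    relations between two reflections reduce to arithmetic with two scalars. *)
Lemma reflect_pt_comb v i j a b : reflect_pt (a *: minus_coroot i + b *: minus_coroot j + v) i =
  (simple_root v i - a + b * cartan i j) *: minus_coroot i + b *: minus_coroot j + v.
Proof.
rewrite /reflect_pt; have -> : simple_root (a *: minus_coroot i + b *: minus_coroot j + v) i =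
    a * cartan i i + b * cartan i j + simple_root v i by rewrite -addrA !simple_root_lin addrA.
rewrite cartan_ii (addrA _ (_ + _) v) (addrA _ (_ *: _)) -scalerDl.
by congr (_ *: _ + _ + _); ring.
Qed.

(** By [reflect_pt_comb] the two scalars return to zero, for each value of the
    Cartan entries. *)
Lemma iter_reflect_coxeter v i j :
  iter (coxeter_matrix_B i j) (fun u => reflect_pt (reflect_pt u i) j) v = v.
Proof.
rewrite /coxeter_matrix_B; case: ifP => [/eqP/val_inj ->|nij]; first by rewrite /= reflect_ptK.
have step a b : reflect_pt (reflect_pt (a *: minus_coroot i + b *: minus_coroot j + v) i) j =
   let a' := simple_root v i - a + b * cartan i j in
   a' *: minus_coroot i + (simple_root v j - b + a' * cartan j i) *: minus_coroot j + v.
  rewrite reflect_pt_comb /= [_ *: minus_coroot i + _]addrC reflect_pt_comb.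
  by rewrite [_ *: minus_coroot j + _]addrC.
have nij' : i != j by rewrite -val_eqE nij.
have -> m : iter m (fun u => reflect_pt (reflect_pt u i) j) v =
    iter m (fun u => reflect_pt (reflect_pt u i) j) (0 *: minus_coroot i + 0 *: minus_coroot j + v).
  by rewrite !scale0r !add0r.
move: step; rewrite !cartanE [j == i]eq_sym (negbTE nij').
rewrite [(i == j.+1 :> nat) || _]orbC ![_.+1 == _]eq_sym.
have fin a b : a = 0 -> b = 0 -> a *: minus_coroot i + b *: minus_coroot j + v = v.
  by move=> -> ->; rewrite !scale0r !add0r.
case: ifP => _ step; last by rewrite /= !step /=; apply: fin; ring.
move: step; case: (i =P 0%N :> nat) => /= [i0|_]; case: (j =P 0%N :> nat) => /= [j0|_].
- by move: nij; rewrite i0 j0.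
all: by move=> step; rewrite !step /=; apply: fin; ring.
Qed.

(** A regular dominant point; its face is the fundamental chamber. *)
Definition rho : pt := \row_i (i.+1)%:R.

Lemma ext_rho_inj : injective (ext rho).
Proof.
move=> [i b] [j c]; rewrite /ext !mxE /= => e.
have hi : 0 < i.+1%:R :> rat by rewrite ltr0n.
have hj : 0 < j.+1%:R :> rat by rewrite ltr0n.
case: b e => /= e; case: c e => /= e; rewrite ?expr0 ?expr1 in e; try (exfalso; lra).
- have /eqP : i.+1%:R = j.+1%:R :> rat by lra.
  by rewrite eqr_nat eqSS => /eqP/val_inj ->.
- have /eqP : i.+1%:R = j.+1%:R :> rat by lra.
  by rewrite eqr_nat eqSS => /eqP/val_inj ->.
Qed.

Lemma simple_root_rho_gt0 i : 0 < simple_root rho i.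
Proof.
rewrite simple_rootE !mxE /=; have : 0 < i.+1%:R :> rat by rewrite ltr0n.
case: eqP => /= [_|/eqP]; first by lra.
by rewrite -lt0n => i0 _; rewrite prednK // subr_gt0 ltr_nat.
Qed.

(** Only permutations that commute with negation act on points. *)
Definition odd_fun (g : {perm sidx}) := forall x, g (neg x) = neg (g x).

Lemma odd_funV g : odd_fun g -> odd_fun g^-1%g.
Proof. by move=> og x; apply: (@perm_inj _ g); rewrite og !permKV. Qed.

Definition act_pt v (g : {perm sidx}) : pt := \row_i ext v (g^-1 (root_head i))%g.

Lemma ext_act v g x : odd_fun g -> ext (act_pt v g) x = ext v (g^-1 x)%g.
Proof.
move=> og; case: x => i b; rewrite {1}/ext mxE /=.
case: b; rewrite ?expr0 ?expr1 ?mul1r //.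
have -> : (i, true) = neg (root_head i) by [].
by rewrite (odd_funV og) ext_neg mulN1r.
Qed.

Definition sperm j : {perm sidx} := perm (inv_inj (@reflect_indexK j)).

Lemma spermV j : ((sperm j)^-1 = sperm j)%g.
Proof.
apply/permP => x; apply: (@perm_inj _ (sperm j)).
by rewrite permKV !permE /= reflect_indexK.
Qed.

Lemma odd_sperm j : odd_fun (sperm j).
Proof. by move=> x; rewrite !permE reflect_index_neg. Qed.

Lemma act_sperm v j : act_pt v (sperm j) = reflect_pt v j.
Proof.
apply: ext_inj => x; rewrite ext_act; last exact: odd_sperm.
by rewrite spermV permE ext_reflect.
Qed.

Lemma odd_funM g h : odd_fun g -> odd_fun h -> odd_fun (g * h)%g.
Proof. by move=> og oh x; rewrite !permM og oh. Qed.

Lemma odd_fun1 : odd_fun 1%g.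
Proof. by move=> x; rewrite !perm1. Qed.

Lemma actM v g h : odd_fun g -> odd_fun h -> act_pt v (g * h)%g = act_pt (act_pt v g) h.
Proof.
move=> og oh; apply: ext_inj => x.
by rewrite !ext_act ?invMg ?permM //; exact: odd_funM.
Qed.

Lemma act1 v : act_pt v 1%g = v.
Proof. by apply: ext_inj => x; rewrite ext_act ?invg1 ?perm1 //; exact: odd_fun1. Qed.

(** A relation between odd permutations can be tested on [rho], whose signed
    coordinates are pairwise distinct. *)
Lemma sperm_coxeter i j : ((sperm i * sperm j) ^+ coxeter_matrix_B i j = 1)%g.
Proof.
have oij : odd_fun (sperm i * sperm j)%g by apply: odd_funM; apply: odd_sperm.
have oX m : odd_fun ((sperm i * sperm j) ^+ m)%g.
  elim: m => [|m IH]; first exact: odd_fun1.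
  by rewrite expgS; exact: odd_funM.
have e m v : act_pt v ((sperm i * sperm j) ^+ m)%g =
    iter m (fun u => reflect_pt (reflect_pt u i) j) v.
  elim: m => [|m IH]; first by rewrite act1.
  rewrite expgSr actM // IH actM; [|exact: odd_sperm..].
  by rewrite !act_sperm.
move: (e (coxeter_matrix_B i j) rho) (oX (coxeter_matrix_B i j)).
rewrite iter_reflect_coxeter; set g := (_ ^+ _)%g => eg og.
apply: invg_inj; rewrite invg1; apply/permP => x; rewrite perm1.
by apply: ext_rho_inj; rewrite -ext_act // eg.
Qed.

End Reflections.

(** * The Coxeter group acting on points, and its length *)

(** What is used of a Coxeter system of type B: the labelled generators, their
    relations, and the action on signed indices. *)
Record typeB_action (n : nat) (gT : finGroupType) (S : {set gT}) := TypeBAction {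
  gen : 'I_n -> gT;
  signed_perm : gT -> {perm signed_index n};
  signed_permM : {morph signed_perm : x y / (x * y)%g};
  signed_perm_gen : forall i, signed_perm (gen i) = sperm i;
  gen_full : <<S>>%g = [set: gT];
  gen_inj : injective gen;
  genE : S = [set gen i | i : 'I_n];
  gen_order : forall i j, #[(gen i * gen j)%g]%g = coxeter_matrix_B i j
}.

(** The permutations [sperm i] satisfy the defining relations, so the universal
    property of the presentation yields the action. *)
Lemma typeB_actionP n (gT : finGroupType) (S : {set gT}) :
  coxeter_system S -> type_B n S -> inhabited (typeB_action n S).
Proof.
move=> [genS _ univ] [s [s_inj SE s_ord]].
pose f (g : gT) : {perm signed_index n} :=
  if [pick i | s i == g] is Some i then sperm i else 1%g.
have fs i : f (s i) = sperm i.
  rewrite /f; case: pickP => [j /eqP/s_inj -> //|/(_ i)].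
  by rewrite eqxx.
have [|phi phiM phis] := univ {perm signed_index n} f.
  move=> ? ?; rewrite SE => /imsetP[i _ ->] /imsetP[j _ ->].
  by rewrite !fs s_ord sperm_coxeter.
constructor; apply: (@TypeBAction n gT S s phi) => //.
by move=> i; rewrite phis ?fs // SE imset_f.
Qed.

Section Action.
Variables (n : nat) (gT : finGroupType) (S : {set gT}) (B : typeB_action n S).
Local Notation pt := 'rV[rat]_n.
Local Notation sidx := (signed_index n).
Local Notation s := (gen B).
Local Notation rho := (rho n).
Implicit Types (u v : pt) (x y : sidx) (i j : 'I_n) (w g : gT).
Local Notation "'l'" := (cox_length S).

Lemma gen_in i : s i \in S.
Proof. by rewrite {2}(genE B) imset_f. Qed.

Lemma gen_sq i : (s i * s i = 1)%g.
Proof.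
by have := expg_order (s i * s i)%g; rewrite gen_order /coxeter_matrix_B eqxx expg1.
Qed.

Lemma genK w i : (w * s i * s i = w)%g.
Proof. by rewrite -mulgA gen_sq mulg1. Qed.

Lemma word_exists w : exists k, w \in (S ^+ k)%g.
Proof.
have : w \in <<S>>%g by rewrite (gen_full B) inE.
move=> /gen_prodgP[k [c Sc ->]]; exists k.
elim: k c Sc => [|k IH] c Sc; first by rewrite big_ord0 expg0 inE.
by rewrite big_ord_recr expgSr /= mem_mulg //; apply: IH => i.
Qed.

Lemma cox_length_mem w : w \in (S ^+ l w)%g.
Proof.
rewrite /cox_length /least; case: pselect => [e|[]]; last exact: word_exists.
by case: ex_minnP.
Qed.

Lemma cox_length_le w k : w \in (S ^+ k)%g -> (l w <= k)%N.
Proof.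
move=> wk; rewrite /cox_length /least; case: pselect => [e|[]]; last exact: word_exists.
by case: ex_minnP => m _; apply.
Qed.

Lemma cox_length_step w i : (l (w * s i) <= (l w).+1)%N.
Proof.
by apply: cox_length_le; rewrite expgSr mem_mulg ?cox_length_mem ?gen_in.
Qed.

(** The last letter of a shortest word for [w] is a descent. *)
Lemma descent_exists w : w != 1%g -> exists i, (l (w * s i) < l w)%N.
Proof.
move=> w1; have := cox_length_mem w.
case E: (l w) => [|k]; first by rewrite expg0 inE (negbTE w1).
rewrite expgSr => /mulsgP[u t uk]; rewrite {1}(genE B) => /imsetP[i _ ->] ew.
by exists i; rewrite ew genK ltnS cox_length_le.
Qed.

Lemma signed_perm1 : signed_perm B 1%g = 1%g.
Proof.
by apply: (mulgI (signed_perm B 1%g)); rewrite -signed_permM !mulg1.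
Qed.

Lemma signed_permV w : signed_perm B w^-1%g = ((signed_perm B w)^-1)%g.
Proof.
by apply: (mulgI (signed_perm B w)); rewrite -signed_permM !mulgV signed_perm1.
Qed.

Lemma gen_ind (P : gT -> Prop) :
  P 1%g -> (forall w i, P w -> P (w * s i)%g) -> forall w, P w.
Proof.
move=> P1 Ps w; have [k] := word_exists w; elim: k w => [|k IH] w.
  by rewrite expg0 inE => /eqP ->.
rewrite expgSr => /mulsgP[u t uk]; rewrite {1}(genE B) => /imsetP[i _ ->] ->.
by apply: Ps; apply: IH.
Qed.

Lemma odd_signed_perm w : odd_fun (signed_perm B w).
Proof.
elim/gen_ind: w => [|w i IH]; first by rewrite signed_perm1; exact: odd_fun1.
by rewrite signed_permM signed_perm_gen; refine (odd_funM IH (@odd_sperm n i)).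
Qed.

(** The inverse makes this a left action in spite of the convention for
    products of permutations; the action on points is then on the right. *)
Definition index_act w x : sidx := signed_perm B w^-1%g x.
Definition point_act v w : pt := act_pt v (signed_perm B w).

Lemma index_act_neg w x : index_act w (neg x) = neg (index_act w x).
Proof. exact: odd_signed_perm. Qed.

Lemma index_act1 x : index_act 1%g x = x.
Proof. by rewrite /index_act invg1 signed_perm1 perm1. Qed.

Lemma index_actM w g x : index_act (w * g)%g x = index_act w (index_act g x).
Proof. by rewrite /index_act invMg signed_permM permM. Qed.

Lemma index_actK w : cancel (index_act w) (index_act w^-1%g).
Proof. by move=> x; rewrite -index_actM mulVg index_act1. Qed.

Lemma index_act_inj w : injective (index_act w).
Proof. exact: can_inj (@index_actK w). Qed.

Lemma ext_point_act v w x : ext (point_act v w) x = ext v (index_act w x).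
Proof.
by rewrite ext_act; [rewrite /index_act signed_permV|exact: odd_signed_perm].
Qed.

Lemma point_act1 v : point_act v 1%g = v.
Proof. by apply: ext_inj => x; rewrite ext_point_act index_act1. Qed.

Lemma point_actM v w g : point_act v (w * g)%g = point_act (point_act v w) g.
Proof. by apply: ext_inj => x; rewrite !ext_point_act index_actM. Qed.

Lemma point_act_gen v i : point_act v (s i) = reflect_pt v i.
Proof. by rewrite /point_act signed_perm_gen act_sperm. Qed.

Lemma simple_root_point_actM v w j i : simple_root (point_act v (w * s j)%g) i =
  simple_root (point_act v w) i + simple_root (point_act v w) j * cartan i j.
Proof. by rewrite point_actM point_act_gen simple_root_reflect. Qed.

Lemma coxeter_cartan i j : i != j ->
  [\/ [/\ coxeter_matrix_B i j = 2%N, cartan i j = 0 & cartan j i = 0],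
      [/\ coxeter_matrix_B i j = 3%N, cartan i j = 1 & cartan j i = 1] |
      [/\ coxeter_matrix_B i j = 4%N, 0 < cartan i j & cartan i j * cartan j i = 2]].
Proof.
move=> nij; rewrite !cartanE [j == i]eq_sym (negbTE nij) /coxeter_matrix_B val_eqE (negbTE nij).
rewrite [(i == j.+1 :> nat) || _]orbC ![_.+1 == _]eq_sym.
case: ifP => _; last by constructor 1.
case: (i =P 0%N :> nat) => /= [i0|_]; case: (j =P 0%N :> nat) => /= [j0|_].
- by move: nij; rewrite -val_eqE /= i0 j0.
- by constructor 3.
- by constructor 3.
- by constructor 2.
Qed.

(** The braid relation, written so that it rewrites [w * s i] for a [w] ending
    with [s j]. *)
Lemma gen_braid i j : i != j ->
  s i = (s j * (s i * s j) ^+ (coxeter_matrix_B i j).-1)%g.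
Proof.
move=> nij; have := expg_order (s i * s j)%g; rewrite gen_order.
have m_gt0 : (0 < coxeter_matrix_B i j)%N.
  by rewrite /coxeter_matrix_B; do ![case: ifP => _].
rewrite -{1}(prednK m_gt0) expgS -mulgA => e.
by apply: (mulgI (s i)); rewrite gen_sq e.
Qed.

(** The argument of Tits, by induction on the length: strip from [w] letters
    [s j], [s i], [s j], ... as long as the length drops. Where it stops at [v],
    both simple roots are positive on [v] by induction, and the root [i] of [w]
    is a nonnegative combination of them. It must stop before the braid relation
    applies, for otherwise [w * s i] would be shorter than [w]. *)
Lemma no_descent_pos w i : ~~ (l (w * s i) < l w)%N -> 0 < simple_root (point_act rho w) i.
Proof.
have [k] := ubnP (l w); elim: k w i => // k IH w i wk ndi.
have [->|w1] := eqVneq w 1%g; first by rewrite point_act1 simple_root_rho_gt0.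
have [j dj] := descent_exists w1.
have nij : i != j by apply: contraNneq ndi => ->.
have up g t : (l (g * s t) <= (l g).+1)%N := cox_length_step g t.
have [w1' def_w1] : exists g, g = (w * s j)%g by exists (w * s j)%g.
rewrite -def_w1 in dj.
have ew1 : w = (w1' * s j)%g by rewrite def_w1 genK.
have lt1 : (l w1' < k)%N by apply: leq_trans dj _.
have pos1 : 0 < simple_root (point_act rho w1') j.
  by apply: IH; [exact: lt1|rewrite -ew1 -leqNgt ltnW].
have [d1|nd1] := boolP (l (w1' * s i) < l w1')%N; last first.
  have pos1i := IH w1' i lt1 nd1.
  by rewrite ew1 simple_root_point_actM ltr_wpDr // mulr_ge0 ?cartan_ge0 // ltW.
have [w2 def_w2] : exists g, g = (w1' * s i)%g by exists (w1' * s i)%g.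
rewrite -def_w2 in d1.
have ew2 : w1' = (w2 * s i)%g by rewrite def_w2 genK.
have lt2 : (l w2 < k)%N by apply: ltn_trans d1 lt1.
have pos2 : 0 < simple_root (point_act rho w2) i.
  by apply: IH => //; rewrite -ew2 -leqNgt ltnW.
have far g : (w * s i)%g = g -> (l g < l w)%N -> False by move=> <- h; rewrite h in ndi.
have br := gen_braid nij.
have [[m cij cji]|[m cij cji]|[m cij cc]] := coxeter_cartan nij.
- exfalso; apply: (far (w2 * s j)%g); first by rewrite br m expg1 def_w2 def_w1 !mulgA.
  by have := up w2 j; lia.
- have [d2|nd2] := boolP (l (w2 * s j) < l w2)%N; last first.
    have pos2j := IH w2 j lt2 nd2.
    rewrite ew1 ew2 !simple_root_point_actM !cartan_ii cij cji; lra.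
  exfalso; apply: (far (w2 * s j * s i * s j)%g).
    by rewrite [in LHS]br m !expgS expg0 mulg1 def_w2 def_w1 !mulgA.
  by have := up (w2 * s j)%g i; have := up (w2 * s j * s i)%g j; lia.
have cjip : 0 < cartan j i by rewrite -(pmulr_rgt0 _ cij) cc.
have [d2|nd2] := boolP (l (w2 * s j) < l w2)%N; last first.
  have pos2j := IH w2 j lt2 nd2.
  rewrite ew1 ew2 !simple_root_point_actM !cartan_ii.
  have -> a b : a + a * -2 + (b + a * cartan j i) * cartan i j =
    a + b * cartan i j + a * (cartan i j * cartan j i - 2) by ring.
  by rewrite cc subrr mulr0 addr0 addr_gt0 // mulr_gt0.
have [w3 def_w3] : exists g, g = (w2 * s j)%g by exists (w2 * s j)%g.
rewrite -def_w3 in d2.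
have ew3 : w2 = (w3 * s j)%g by rewrite def_w3 genK.
have lt3 : (l w3 < k)%N by apply: ltn_trans d2 lt2.
have pos3 : 0 < simple_root (point_act rho w3) j.
  by apply: IH => //; rewrite -ew3 -leqNgt ltnW.
have [d3|nd3] := boolP (l (w3 * s i) < l w3)%N; last first.
  have pos3i := IH w3 i lt3 nd3.
  rewrite ew1 ew2 ew3 !simple_root_point_actM !cartan_ii.
  set a := simple_root _ i; set b := simple_root _ j.
  set e := (X in 0 < X); have -> : e = a + (cartan i j * cartan j i - 2) * (a + b * cartan i j).
    by rewrite /e; ring.
  by rewrite cc subrr mul0r addr0.
exfalso; apply: (far (w3 * s i * s j * s i * s j)%g).
  by rewrite [in LHS]br m !expgS expg0 mulg1 def_w3 def_w2 def_w1 !mulgA.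
have := up (w3 * s i)%g j; have := up (w3 * s i * s j)%g i.
by have := up (w3 * s i * s j * s i)%g j; lia.
Qed.

(** For the converse implication [no_descent_pos] is applied to [w * s i], on
    which the root [i] has the opposite sign. *)
Lemma length_lt_pos w i : (l w < l (w * s i))%N = (0 < simple_root (point_act rho w) i).
Proof.
have [lt|le] := ltnP (l w) (l (w * s i)).
  by rewrite no_descent_pos // -leqNgt ltnW.
apply/esym/negbTE; rewrite -leNgt.
have: ~~ (l (w * s i * s i) < l (w * s i))%N by rewrite genK -leqNgt.
move=> /no_descent_pos; rewrite simple_root_point_actM cartan_ii => h; lra.
Qed.

End Action.

(** * Dominant points and chambers *)

Section Dominance.
Variable n : nat.
Local Notation pt := 'rV[rat]_n.
Local Notation sidx := (signed_index n).
Local Notation rho := (rho n).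
Implicit Types (u v : pt) (x y : sidx) (i j : 'I_n).

Definition pos_comb (L : pt -> rat) :=
  exists k : 'I_n -> rat, (forall i, 0 <= k i) /\ forall v, L v = \sum_i k i * simple_root v i.

Lemma pos_comb_ext L L' : L =1 L' -> pos_comb L -> pos_comb L'.
Proof. by move=> e [k [k0 h]]; exists k; split=> // v; rewrite -e h. Qed.

Lemma pos_comb0 : pos_comb (fun=> 0).
Proof.
by exists (fun=> 0); split=> // v; rewrite big1 // => i _; rewrite mul0r.
Qed.

Lemma pos_combD L L' : pos_comb L -> pos_comb L' -> pos_comb (fun v => L v + L' v).
Proof.
move=> [k [k0 h]] [k' [k0' h']]; exists (fun i => k i + k' i); split=> [i|v].
  by rewrite addr_ge0.
by rewrite h h' -big_split; apply: eq_bigr => i _; rewrite mulrDl.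
Qed.

Lemma pos_comb_simple_root c i : 0 <= c -> pos_comb (fun v => c * simple_root v i).
Proof.
move=> c0; exists (fun j => c * (j == i)%:R); split=> [j|v].
  by rewrite mulr_ge0 ?ler0n.
rewrite (bigD1 i) //= eqxx mulr1 big1 ?addr0 // => j /negbTE ->.
by rewrite mulr0 mul0r.
Qed.

Lemma pos_comb_coord i : pos_comb (fun v => v 0 i).
Proof.
have [m] := ubnP (i : nat); elim: m i => // m IH i im.
have [i0|i0] := eqVneq (i : nat) 0%N.
  apply: pos_comb_ext (pos_comb_simple_root i (_ : 0 <= 1 / 2)) => // v.
  by rewrite simple_rootE i0 /=; field.
have h : (opred i < m)%N by rewrite /=; lia.
have h1 : (0 : rat) <= 1 by [].
apply: pos_comb_ext (pos_combD (pos_comb_simple_root i h1) (IH _ h)) => v /=.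
by rewrite simple_rootE (negbTE i0); ring.
Qed.

Lemma pos_comb_diff i j : (i <= j)%N -> pos_comb (fun v => v 0 j - v 0 i).
Proof.
have [m] := ubnP (j : nat); elim: m j => // m IH j jm.
rewrite leq_eqVlt => /orP[/eqP/val_inj ->|ij].
  by apply: pos_comb_ext pos_comb0 => v; rewrite subrr.
have h : (opred j < m)%N by rewrite /=; lia.
have h2 : (i <= opred j)%N by rewrite /=; lia.
have h1 : (0 : rat) <= 1 by [].
apply: pos_comb_ext (pos_combD (pos_comb_simple_root j h1) (IH _ h h2)) => v /=.
rewrite simple_rootE ifN; first by ring.
by rewrite -lt0n; lia.
Qed.

(** These differences of coordinates are, up to a positive factor, zero and the
    positive roots; this is their expression in simple roots. *)
Lemma pos_root_comb x y : ext rho x <= ext rho y ->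
  pos_comb (fun v => ext v y - ext v x).
Proof.
case: x y => [i b] [j c]; rewrite /ext !mxE /=.
have hi : 0 < i.+1%:R :> rat by rewrite ltr0n.
have hj : 0 < j.+1%:R :> rat by rewrite ltr0n.
case: b; case: c; rewrite /= ?expr0 ?expr1 => le.
- apply: pos_comb_ext (pos_comb_diff (_ : j <= i)%N) => [v|]; first by ring.
  by rewrite -ltnS -[(j < _)%N]ltnS -(ler_nat rat) in le *; lra.
- by apply: pos_comb_ext (pos_combD (pos_comb_coord i) (pos_comb_coord j)) => v; ring.
- by exfalso; lra.
- apply: pos_comb_ext (pos_comb_diff (_ : i <= j)%N) => [v|]; first by ring.
  by rewrite !mul1r ler_nat in le.
Qed.

Definition dominant v := forall i, 0 <= simple_root v i.

Lemma dominant_mono v x y :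
  dominant v -> ext rho x <= ext rho y -> ext v x <= ext v y.
Proof.
move=> dv /pos_root_comb[k [k0 h]]; rewrite -subr_ge0 h.
by apply: sumr_ge0 => i _; rewrite mulr_ge0.
Qed.

(** Every positive root is a nonnegative combination of simple ones, so the ties
    of a dominant point are governed by the simple roots that vanish on it. *)
Lemma dominant_face u v : dominant u -> dominant v ->
  (forall i, simple_root u i = 0 -> simple_root v i = 0) -> face_of v \subset face_of u.
Proof.
move=> du dv z; apply/subsetP => -[x y]; rewrite !in_face_of.
case: (leP (ext rho y) (ext rho x)) => [/(dominant_mono dv)|/ltW le].
  by rewrite leNgt => /negbTE ->.
move=> lt; rewrite lt_neqAle (dominant_mono du le) andbT; apply/eqP => e.
have [k [k0 h]] := pos_root_comb le.
have /eqP := h u; rewrite e subrr eq_sym psumr_eq0; last first.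
  by move=> i _; rewrite mulr_ge0.
move=> /allP hz; have := lt; rewrite -subr_gt0 h big1 ?ltxx // => i _.
have := hz i (mem_index_enum i); rewrite mulf_eq0 => /orP[/eqP->|/eqP/z ->].
  by rewrite mul0r.
by rewrite mulr0.
Qed.

Lemma rho_dominant : dominant rho.
Proof. by move=> i; rewrite ltW ?simple_root_rho_gt0. Qed.

(** Pairing with [rho] strictly increases under a reflection in a negative
    simple root. *)
Definition rho_pairing v := \sum_i rho 0 i * v 0 i.

Lemma rho_pairing_reflect v j : rho_pairing (reflect_pt v j) = rho_pairing v - simple_root v j.
Proof.
rewrite /rho_pairing; under eq_bigr => i _ do rewrite reflect_ptE mulrDr mulrCA.
rewrite big_split /= -mulr_sumr addrC; congr (_ + _); rewrite -mulrN1; congr (_ * _).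
have -> : -1 = (if j == 0%N :> nat then 0 else rho 0 (opred j)) - rho 0 j.
  rewrite !mxE /=; case: eqP => [->|/eqP j0]; first by ring.
  by rewrite prednK ?lt0n // -[in RHS]natr1; ring.
under eq_bigr => i _ do rewrite minus_corootE mulrBr.
rewrite big_split sumrN /=; congr (_ - _).
  case: eqP => [_|j0]; first by rewrite big1 // => i _; rewrite mulr0.
  rewrite (bigD1 (opred j)) //= eqxx mulr1 big1 ?addr0 // => i /negbTE.
  by rewrite -val_eqE /= => ->; rewrite mulr0.
rewrite (bigD1 j) //= eqxx mulr1 big1 ?addr0 // => i /negbTE.
by rewrite -val_eqE /= => ->; rewrite mulr0.
Qed.

End Dominance.

Section Chambers.
Variables (n : nat) (gT : finGroupType) (S : {set gT}) (B : typeB_action n S).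
Local Notation pt := 'rV[rat]_n.
Local Notation sidx := (signed_index n).
Local Notation s := (gen B).
Local Notation point_act := (point_act B).
Local Notation index_act := (index_act B).
Local Notation rho := (rho n).
Local Notation face := {set sidx * sidx}.
Implicit Types (u v : pt) (x y : sidx) (i j : 'I_n) (w g h : gT) (F G H : face).
Local Notation "'l'" := (cox_length S).

(** A point of the orbit that maximizes the pairing with [rho] is dominant. *)
Lemma to_dominant v : exists w, dominant (point_act v w).
Proof.
have [w _ wmax] := @Order.TotalTheory.arg_maxP _ _ _ (1%g : gT) predT
  (fun w => rho_pairing (point_act v w)) isT.
exists w => i; have := wmax (w * s i)%g isT.
by rewrite point_actM point_act_gen rho_pairing_reflect /= gerBl.
Qed.

Definition face_act F w : face := [set p | (index_act w p.1, index_act w p.2) \in F].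

Lemma face_of_point_act v w : face_of (point_act v w) = face_act (face_of v) w.
Proof. by apply/setP => -[x y]; rewrite !inE /= !ext_point_act. Qed.

Lemma face_actM F w g : face_act F (w * g)%g = face_act (face_act F w) g.
Proof. by apply/setP => -[x y]; rewrite !inE /= !index_actM. Qed.

Lemma face_act1 F : face_act F 1%g = F.
Proof. by apply/setP => -[x y]; rewrite !inE /= !index_act1. Qed.

Lemma face_actK w : cancel (face_act^~ w) (face_act^~ w^-1%g).
Proof. by move=> F; rewrite -face_actM mulgV face_act1. Qed.

Lemma face_act_inj w : injective (face_act^~ w).
Proof. exact: can_inj (face_actK w). Qed.

Lemma face_mul_act F G w : face_mul (face_act F w) (face_act G w) = face_act (face_mul F G) w.
Proof. by apply/setP => -[x y]; rewrite !inE. Qed.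

Lemma is_face_act F w : is_face F -> is_face (face_act F w).
Proof. by move=> [v ->]; exists (point_act v w); rewrite face_of_point_act. Qed.

Definition chamber w : face := face_of (point_act rho w).

Lemma chamber1 : chamber 1%g = face_of rho. Proof. by rewrite /chamber point_act1. Qed.

Lemma chamber_act w g : face_act (chamber w) g = chamber (w * g)%g.
Proof. by rewrite /chamber -face_of_point_act -point_actM. Qed.

Lemma simple_in_face v i : ((root_tail i, root_head i) \in face_of v) = (0 < simple_root v i).
Proof. by rewrite in_face_of /simple_root subr_gt0. Qed.

(** Fixing the fundamental chamber leaves [w] without descents. *)
Lemma chamber_eq1 w : chamber w = chamber 1%g -> w = 1%g.
Proof.
move=> e; apply/eqP; apply: contraT => /(descent_exists B)[i].
rewrite ltnNge ltnW // length_lt_pos -simple_in_face -/(chamber w) e.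
by rewrite chamber1 simple_in_face simple_root_rho_gt0.
Qed.

Lemma chamber_inj : injective chamber.
Proof.
move=> w g e; apply: (mulIg g^-1%g); rewrite mulgV; apply: chamber_eq1.
by rewrite -chamber_act e chamber_act mulgV.
Qed.

Lemma chamber_exists v : injective (ext v) -> exists w, face_of v = chamber w.
Proof.
move=> iv; have [w dw] := to_dominant v; exists w^-1%g.
have pw i : simple_root (point_act v w) i != 0.
  rewrite /simple_root !ext_point_act subr_eq0; apply/eqP => /iv/index_act_inj.
  rewrite /root_head /root_tail; case: eqP => // i0 [] /(congr1 val) /=; lia.
apply: (@face_act_inj w); rewrite /= chamber_act mulVg chamber1 -face_of_point_act.
apply/eqP; rewrite eqEsubset; apply/andP; split; apply: dominant_face => //.
- exact: rho_dominant.
- by move=> i /eqP; rewrite gt_eqF ?simple_root_rho_gt0.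
- exact: rho_dominant.
- by move=> i /eqP; rewrite (negbTE (pw i)).
Qed.

(** A tie in [face_mul F (chamber w)] would be a tie in [chamber w]. *)
Lemma chamber_face_mul F w : is_face F -> exists g, face_mul F (chamber w) = chamber g.
Proof.
move=> fF; have [v ev] : is_face (face_mul F (chamber w)).
  by apply: is_face_mul => //; exists (point_act rho w).
rewrite ev; apply: chamber_exists => x y e.
have [v0 eF] := fF.
have : (x, y) \notin face_of v by rewrite in_face_of e ltxx.
have : (y, x) \notin face_of v by rewrite in_face_of e ltxx.
rewrite -ev eF !in_face_mul_face_of !in_face_of !ext_point_act.
case: ltgtP => //= _; case: ltgtP => //= h _ _.
by apply: (@index_act_inj _ _ _ B w); apply: ext_rho_inj.
Qed.

Lemma face_le_dominant v G : face_mul (face_of v) G = chamber 1%g -> dominant v.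
Proof.
move=> e i; rewrite leNgt; apply/negP => neg.
have : (root_head i, root_tail i) \in chamber 1%g.
  by rewrite -e in_face_mul_face_of -subr_lt0 -/(simple_root v i) neg.
by rewrite chamber1 in_face_of -subr_lt0 -/(simple_root rho i) ltNge ltW ?simple_root_rho_gt0.
Qed.

(** Induction on the length of [w]: at a descent [i] of [w] the simple root is
    both nonnegative and nonpositive on [point_act v w], so [s i] fixes it. *)
Lemma dominant_orbit v w : dominant v -> dominant (point_act v w) -> point_act v w = v.
Proof.
move=> dv; have [m] := ubnP (l w); elim: m w => // m IH w wm dw.
have [->|w1] := eqVneq w 1%g; first by rewrite point_act1.
have [i di] := descent_exists B w1.
have le0 : simple_root (point_act v w) i <= 0.
  rewrite /simple_root !ext_point_act subr_le0; apply: dominant_mono => //.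
  rewrite -!ext_point_act -subr_le0 -/(simple_root _ i) leNgt -length_lt_pos.
  by rewrite -leqNgt ltnW.
have e0 : simple_root (point_act v w) i = 0 by apply/eqP; rewrite eq_le le0 dw.
have e : point_act v (w * s i)%g = point_act v w.
  by rewrite point_actM point_act_gen /reflect_pt e0 scale0r add0r.
by rewrite -e; apply: IH; [apply: leq_trans di _|rewrite e].
Qed.

End Chambers.

(** * From invariant combinations of faces to the descent algebra *)

Section Bidigare.
Variables (n : nat) (gT : finGroupType) (S : {set gT}) (B : typeB_action n S).
Local Notation pt := 'rV[rat]_n.
Local Notation sidx := (signed_index n).
Local Notation s := (gen B).
Local Notation point_act := (point_act B).
Local Notation index_act := (index_act B).
Local Notation rho := (rho n).
Local Notation face := {set sidx * sidx}.
Local Notation chamber := (chamber B).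
Local Notation face_act := (face_act B).
Local Notation coefs := (coefs (signed_index n)).
Implicit Types (u v : pt) (x y : sidx) (i j : 'I_n) (w g h : gT) (F G H : face).
Implicit Types (a b : coefs) (I J : {set gT}).

Definition invariant_coefs a :=
  (forall F w, a (face_act F w) = a F) /\ (forall F, a F != 0 -> is_face F).

Lemma invariant_conv b a : invariant_coefs b -> invariant_coefs a -> invariant_coefs (conv b a).
Proof.
move=> [b1 b2] [a1 a2]; split=> [H w|H].
  rewrite /conv (reindex_inj (@face_act_inj _ _ _ B w)) /=.
  apply: eq_bigr => G _; rewrite (reindex_inj (@face_act_inj _ _ _ B w)) /=.
  apply: eq_big => [F|F _]; last by rewrite b1 a1.
  by rewrite face_mul_act (inj_eq (@face_act_inj _ _ _ B w)).
apply: contraNP => nf; apply/eqP; rewrite /conv big1 // => G _; rewrite big1 // => F /eqP e.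
apply/eqP; rewrite mulf_eq0; apply/orP.
have [_|bG] := eqVneq (b G) 0; [by left|right; apply: contra_notT nf => aF].
by rewrite -e; apply: is_face_mul; auto.
Qed.

Lemma invariant1 : invariant_coefs (one_coefs (T := sidx)).
Proof.
split=> [F w|F]; rewrite /one_coefs.
  have e0 : face_act set0 w = set0 by apply/setP => p; rewrite !inE.
  by rewrite -{1}e0 (inj_eq (@face_act_inj _ _ _ B w)).
by rewrite pnatr_eq0 eqb0 negbK => /eqP ->; exact: face0.
Qed.

Lemma invariant_lincomb k a b :
  invariant_coefs a -> invariant_coefs b -> invariant_coefs (lincomb k a b).
Proof.
move=> [a1 a2] [b1 b2]; split=> [F w|F]; rewrite /lincomb ?a1 ?b1 //.
have [a0|aF _] := eqVneq (a F) 0; last exact: a2.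
by rewrite a0 mulr0 add0r; exact: b2.
Qed.

Lemma invariant0 : invariant_coefs (fun=> 0).
Proof. by split=> [//|F]; rewrite eqxx. Qed.

(** The coefficient at [w] is that of the fundamental chamber in [a] times the
    chamber of [w]. If [a] is invariant, it is also that of the chamber of [w^-1]
    in [a] times the fundamental chamber. *)
Definition Psi a : group_alg rat gT :=
  [ffun w => \sum_F (face_mul F (chamber w) == chamber 1%g)%:R * a F].

Lemma Psi_lincomb k a b : Psi (lincomb k a b) = k *: Psi a + Psi b.
Proof.
apply/ffunP => w; rewrite !ffunE.
rewrite -[_ *: _]/(k * _) mulr_sumr -big_split /=.
by apply: eq_bigr => F _; rewrite /lincomb; ring.
Qed.

Lemma Psi0 : Psi (fun=> 0) = 0.
Proof. by apply/ffunP => w; rewrite !ffunE big1 // => F _; rewrite mulr0. Qed.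

Lemma Psi_shift a w g : invariant_coefs a ->
  Psi a (w * g^-1)%g = \sum_F (face_mul F (chamber w) == chamber g)%:R * a F.
Proof.
move=> [a1 _]; rewrite ffunE (reindex_inj (@face_act_inj _ _ _ B g^-1%g)) /=.
apply: eq_bigr => F _; rewrite a1 -chamber_act face_mul_act.
have -> : chamber 1%g = face_act (chamber g) g^-1%g by rewrite chamber_act mulgV.
by rewrite (inj_eq (@face_act_inj _ _ _ B g^-1%g)).
Qed.

Lemma Psi1 : Psi (one_coefs (T := sidx)) = 1.
Proof.
apply/ffunP => w; rewrite !ffunE (bigD1 set0) //= face_mul0 /one_coefs eqxx mulr1.
rewrite big1 ?addr0 => [|F /negbTE ->]; last by rewrite mulr0.
by rewrite (inj_eq (@chamber_inj _ _ _ B)).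
Qed.

(** The face [F] maps the chamber of [w] to some chamber, of [u] say, on which
    [G] then acts; by invariance the first step is read as the coefficient of
    [Psi b] at [w * u^-1]. The order of the factors is reversed. *)
Lemma Psi_conv a b : invariant_coefs b -> Psi (conv a b) = Psi b * Psi a.
Proof.
move=> ib; apply/ffunP => w; rewrite !ffunE sum_conv exchange_big /=.
under [RHS]eq_bigr => h _.
  have -> : Psi b h = \sum_F (face_mul F (chamber w) == chamber (h^-1 * w)%g)%:R * b F.
    by rewrite -Psi_shift // invMg invgK mulKVg.
  rewrite mulr_suml; over.
rewrite [RHS]exchange_big /=; apply: eq_bigr => F _.
have [b0|bF] := eqVneq (b F) 0.
  by rewrite !big1 // => ? _; rewrite b0 !(mulr0, mul0r).
have [u eu] := chamber_face_mul B w (ib.2 F bF).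
rewrite [RHS](bigD1 (w * u^-1)%g) //= invMg invgK mulgKV eu eqxx.
rewrite [X in _ = _ + X]big1 ?addr0; last first.
  move=> h hu; rewrite (inj_eq (@chamber_inj _ _ _ B)) (_ : (_ == _) = false) ?mul0r ?mulr0 //.
  by apply/negbTE; apply: contraNneq hu => ->; rewrite invMg invgK mulKVg.
rewrite ffunE mul1r mulr_sumr; apply: eq_bigr => G _.
by rewrite -face_mulA eu; ring.
Qed.

(** Let [F0] be a maximal face with nonzero coefficient. Going to the side of
    [F0] opposite to a chamber [u] above it gives a chamber [w] such that
    [face_mul F (chamber w) = chamber u] forces [F] to contain [F0]; the
    coefficient of [F0] is then a value of [Psi a]. *)
Lemma Psi_faithful a : invariant_coefs a -> Psi a = 0 -> forall F, a F = 0.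
Proof.
move=> ia Pa F1; apply/eqP; apply: contraT => aF1.
(* Faces are sets of strict inequalities, so that size measures refinement. *)
case: (@arg_maxnP _ F1 (fun F => a F != 0) (fun F => #|F|) aF1) => F0 aF0 maxF.
have [u eu] := chamber_face_mul B 1%g (ia.2 F0 aF0).
have face_opp_face F : is_face F -> is_face (face_opp F).
  by move=> [v ->]; exists (- v); rewrite face_of_opp.
have [w ew] := chamber_face_mul B u (face_opp_face _ (ia.2 F0 aF0)).
have := Psi_shift w u ia; rewrite Pa ffunE => /esym/eqP.
rewrite (bigD1 F0) //= [X in _ + X]big1 ?addr0; last first.
  move=> F nF; have [->|aF] := eqVneq (a F) 0; first by rewrite mulr0.
  case: eqP; rewrite ?mul0r // => e; case/eqP: nF; apply/esym/eqP.
  have le : (#|F| <= #|F0|)%N := maxF _ aF; rewrite eqEcard le andbT; apply/subsetP => p pF0.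
  have pu : p \in chamber u by rewrite -eu inE pF0.
  have npw : p \notin chamber w.
    have : swap p \in chamber w by rewrite -ew inE inE swapK pF0.
    by case: (p) => x y; rewrite !in_face_of; case: ltgtP.
  by move: pu; rewrite -e inE (negbTE npw) andbF orbF.
have -> : face_mul F0 (chamber w) = chamber u.
  rewrite -ew face_mulA.
  have -> : face_mul F0 (face_opp F0) = F0.
    by apply/setP => p; rewrite !inE; do ![case: (_ \in _) => //].
  by rewrite -eu face_mulA face_mul_idK.
by rewrite eqxx mul1r (negbTE aF0).
Qed.

(** A dominant point on which exactly the simple roots in [I] vanish. *)
Definition std_pt I : pt := \row_(i < n) \sum_(j < n | (j <= i)%N) (s j \notin I)%:R.

Lemma simple_root_std I i : simple_root (std_pt I) i =
  (if i == 0%N :> nat then 2 else 1) * (s i \notin I)%:R.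
Proof.
rewrite simple_rootE !mxE; rewrite (bigD1 i) //=; case: eqP => [i0|/eqP i0].
  rewrite big1 ?addr0; first by ring.
  by move=> j /andP[ji]; rewrite -val_eqE /= => nji; exfalso; lia.
rewrite (eq_bigl (fun j : 'I_n => (j <= i.-1)%N)); first by ring.
by move=> j; rewrite -val_eqE /=; apply/idP/idP; lia.
Qed.

Definition std I : face := face_of (std_pt I).

Lemma std_dominant I : dominant (std_pt I).
Proof. by move=> i; rewrite simple_root_std mulr_ge0 //; case: ifP. Qed.

Lemma std_root0 I i : (simple_root (std_pt I) i == 0) = (s i \in I).
Proof.
rewrite simple_root_std mulf_eq0 pnatr_eq0 eqb0 negbK.
by case: ifP => _; rewrite ?oner_eq0 // pnatr_eq0.
Qed.

Lemma dominant_std v : dominant v ->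
  exists2 I, I \in powerset S & face_of v = std I.
Proof.
move=> dv; exists [set s i | i in [pred i | simple_root v i == 0]].
  by rewrite inE; apply/subsetP => _ /imsetP[i _ ->]; exact: gen_in.
set I := [set _ | _ in _].
have sI i : (s i \in I) = (simple_root v i == 0).
  apply/imsetP/idP => [[j] |h]; last by exists i.
  by rewrite inE => h /gen_inj ->.
apply/eqP; rewrite eqEsubset; apply/andP; split; apply: dominant_face => //.
- exact: std_dominant.
- by move=> i /eqP; rewrite std_root0 sI => /eqP.
- exact: std_dominant.
- by move=> i /eqP; rewrite -sI -std_root0 => /eqP.
Qed.

Lemma std_inj : {in powerset S &, injective std}.
Proof.
have h I J : I \in powerset S -> std I = std J -> I \subset J.
  rewrite inE => IS e; apply/subsetP => t tI.
  have := subsetP IS t tI; rewrite {1}(genE B) => /imsetP[i _ ti].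
  rewrite ti -std_root0 eq_le std_dominant andbT leNgt -simple_in_face -/(std J) -e.
  by rewrite simple_in_face -leNgt le_eqVlt std_root0 -ti tI.
by move=> I J IS JS e; apply/eqP; rewrite eqEsubset !h.
Qed.

(** Both sides say that the simple roots in [I] are positive on the point of
    [w]: these are the ties of the standard face. *)
Lemma std_descX I w : I \in powerset S ->
  (face_mul (std I) (chamber w) == chamber 1%g) = (w \in descX S I).
Proof.
rewrite inE => IS; rewrite inE; apply/eqP/forallP => [e t|h].
  apply/implyP => tI; have := subsetP IS t tI; rewrite {1}(genE B) => /imsetP[i _ ti].
  rewrite ti length_lt_pos -simple_in_face.
  have : (root_tail i, root_head i) \in chamber 1%g.
    by rewrite chamber1 simple_in_face simple_root_rho_gt0.
  rewrite -e in_face_mul_face_of -subr_gt0 -/(simple_root _ i) => /orP[|/andP[] //].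
  by move=> hp; move: tI; rewrite ti -std_root0 gt_eqF.
have hs x y : ext rho x < ext rho y -> (x, y) \in face_mul (std I) (chamber w).
  move=> lt; rewrite in_face_mul_face_of.
  have le := dominant_mono (@std_dominant I) (ltW lt).
  rewrite lt_neqAle le andbT; case: eqP => //= e.
  have [k [k0 hk]] := pos_root_comb (ltW lt).
  have := hk (std_pt I); rewrite e subrr => /esym/eqP.
  rewrite psumr_eq0 => [/allP hz|i _]; last by rewrite mulr_ge0 ?std_dominant.
  rewrite in_face_of lt_neqAle; apply/andP; split.
    by rewrite !ext_point_act; apply/eqP => /ext_rho_inj/index_act_inj exy;
       move: lt; rewrite exy ltxx.
  rewrite -subr_ge0 hk; apply: sumr_ge0 => i _.
  have := hz i (mem_index_enum i); rewrite mulf_eq0 => /orP[/eqP->|].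
    by rewrite mul0r.
  rewrite std_root0 => sI; rewrite mulr_ge0 // ltW // -length_lt_pos.
  by have := h (s i); rewrite sI.
apply/setP => -[x y]; rewrite chamber1 in_face_of.
case: ltgtP => [/hs -> //|/hs|/ext_rho_inj ->].
  by rewrite !in_face_mul_face_of !in_face_of; case: ltgtP => //= _; case: ltgtP.
by rewrite in_face_mul_face_of in_face_of !ltxx andbF.
Qed.

Lemma descxE I w : descx S I w = (w \in descX S I)%:R.
Proof.
rewrite /descx sum_ffunE; under eq_bigr => h _ do rewrite ffunE eq_sym.
rewrite big_mkcond /= (bigD1 w) //= eqxx big1 ?addr0; first by case: ifP.
by move=> h /negbTE ->; case: ifP.
Qed.

(** Only faces of the fundamental chamber contribute to [Psi a], and these are
    the standard faces. *)
Lemma PsiE a : invariant_coefs a -> Psi a = \sum_(I in powerset S) a (std I) *: descx S I.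
Proof.
move=> ia; apply/ffunP => w; rewrite ffunE sum_ffunE.
under [RHS]eq_bigr => I IS.
  rewrite ffunE descxE -std_descX // -[_ *: _]/(_ * _) mulrC; over.
rewrite -(big_imset (fun F => (face_mul F (chamber w) == chamber 1%g)%:R * a F) std_inj) /=.
rewrite (bigID (mem (std @: powerset S))) /= addrC big1 ?add0r // => F nF.
have [->|aF] := eqVneq (a F) 0; first by rewrite mulr0.
case: eqP => [e|_]; last by rewrite mul0r.
case/negP: nF; have [v ev] := ia.2 F aF; move: e; rewrite ev.
move=> /face_le_dominant/dominant_std[I IS ->].
exact: imset_f.
Qed.

Definition orb_sum F : coefs := fun H => \sum_w (H == face_act F w)%:R.

Lemma orb_sum_invariant F : is_face F -> invariant_coefs (orb_sum F).
Proof.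
move=> fF; split=> [H g|H].
  rewrite /orb_sum (reindex_inj (mulIg g)) /=; apply: eq_bigr => w _.
  by rewrite face_actM (inj_eq (@face_act_inj _ _ _ B g)).
apply: contraNP => nf; rewrite /orb_sum big1 // => w _; case: eqP => // e.
by case: nf; rewrite e; apply: is_face_act.
Qed.

(** By [PsiE] the orbit sum of [std I] goes to a multiple of [descx S I], because
    distinct standard faces lie in distinct orbits. *)
Lemma descent_algebraP z :
  z \in descent_algebra S <-> exists2 a, invariant_coefs a & z = Psi a.
Proof.
split; last first.
  move=> [a ia ->]; rewrite PsiE //; apply: memv_suml => I IS.
  have sI := @sumv_sup _ _ _ I _ _ (fun I => <[descx S I]>%VS) IS (subvv _).
  by apply: memvZ; rewrite (subvP sI) ?memv_line.
pose P (z : group_alg rat gT) := exists2 a, invariant_coefs a & z = Psi a.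
have lP : lin_closed P.
  split; first by exists (fun=> 0); [exact: invariant0|rewrite Psi0].
  move=> k _ _ [a ia ->] [b ib ->]; exists (lincomb k a b).
    exact: invariant_lincomb.
  by rewrite Psi_lincomb.
suff sub : (descent_algebra S <= vspace_of lP)%VS.
  by move=> /(subvP sub)/memv_of.
apply/subv_sumP => I IS; rewrite -memvE; apply/memv_of.
have iI := orb_sum_invariant (ex_intro _ _ (erefl (std I))).
pose c := orb_sum (std I) (std I).
have c0 : c != 0.
  rewrite /c /orb_sum (bigD1 1%g) //= face_act1 eqxx; apply: lt0r_neq0.
  by rewrite ltr_pwDl //; apply: sumr_ge0 => w _; rewrite ler0n.
exists (lincomb c^-1 (orb_sum (std I)) (fun=> 0)).
  exact: (invariant_lincomb _ iI invariant0).
rewrite Psi_lincomb Psi0 addr0 PsiE // (bigD1 I) //= big1 ?addr0.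
  by rewrite scalerA mulVf // scale1r.
move=> J /andP[JS nJ]; rewrite /orb_sum big1 ?scale0r // => w _.
case: eqP => // e; case/eqP: nJ; apply: std_inj => //.
rewrite e -face_of_point_act; congr face_of; apply: dominant_orbit; first exact: std_dominant.
apply: (@face_le_dominant _ _ _ B _ (chamber 1%g)).
rewrite face_of_point_act -/(std I) -e; apply/eqP; rewrite std_descX // inE.
apply/forallP => t; apply/implyP => tJ.
have tS : t \in S by move: JS; rewrite inE => /subsetP; apply.
move: tS; rewrite {1}(genE B) => /imsetP[i _ ->].
by rewrite length_lt_pos point_act1 simple_root_rho_gt0.
Qed.

End Bidigare.

(** * Faces refining a given face *)

Section Supports.
Variable n : nat.
Local Notation pt := 'rV[rat]_n.
Local Notation sidx := (signed_index n).
Local Notation face := {set sidx * sidx}.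
Implicit Types (u v f g : pt) (x y : sidx) (F G H : face).

Lemma face_supp_face_mull G F : (face_supp G <= face_supp (face_mul G F))%VS.
Proof.
apply/subvP => u /memv_of h; apply/memv_of => x y.
rewrite !inE /swap /= !negb_or => /andP[h1 _] /andP[h2 _]; exact: h.
Qed.

Lemma face_supp_face_mulr G F : (face_supp F <= face_supp (face_mul G F))%VS.
Proof.
apply/subvP => u /memv_of h; apply/memv_of => x y.
rewrite !inE /swap /= !negb_or !negb_and !negbK => /andP[/negbTE -> h1] /andP[/negbTE h2 h3].
by move: h1 h3; rewrite h2 /=; exact: h.
Qed.

Lemma face_supp_face_mul_opp G F : face_supp (face_mul G (face_opp F)) = face_supp (face_mul G F).
Proof.
apply/vspaceP => u.
by apply/idP/idP => /memv_of h; apply/memv_of => x y h1 h2; apply: h;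
   move: h1 h2; rewrite !inE /swap /=; do 4 case: (_ \in _).
Qed.

Lemma face_mul_opp_inj G F F' :
  (face_mul G (face_opp F) == face_mul G (face_opp F')) = (face_mul G F == face_mul G F').
Proof.
apply/eqP/eqP => e; apply/setP => p; have /setP/(_ (swap p)) := e;
  by rewrite !inE ?swapK; do ![case: (_ \in _) => //=].
Qed.

Lemma face_mul_fix_supp g f :
  (face_mul (face_of g) (face_of f) == face_of g) = (f \in face_supp (face_of g)).
Proof.
rewrite face_mul_fix_face_of; apply/idP/idP => [h|/face_supp_face_of h].
  apply/face_supp_face_of => x y /eqP e; apply/eqP.
  by have /forallP/(_ y)/implyP := forallP h x; apply.
by do 2 (apply/forallP => ?); apply/implyP => /eqP/h ->.
Qed.

Lemma face_mul_face_eq g f f' :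
  (forall x y, ext g x = ext g y -> (ext f x < ext f y) = (ext f' x < ext f' y)) ->
  face_mul (face_of g) (face_of f) = face_mul (face_of g) (face_of f').
Proof.
move=> h; apply/setP => -[x y]; rewrite !in_face_mul_face_of !in_face_of.
by case: eqP => //= /h ->.
Qed.

(** Translating by a vector of the span of [g] does not affect the way in which
    ties of [g] are broken. *)
Lemma face_mul_face_scale g u f c : u \in face_supp (face_of g) -> 0 < c ->
  face_mul (face_of g) (face_of (c *: f + u)) = face_mul (face_of g) (face_of f).
Proof.
move=> /face_supp_face_of hu c0; apply: face_mul_face_eq => x y /hu e.
by rewrite !ext_lin e ltrD2r ltr_pM2l.
Qed.

Lemma face_mul_face_opp_neq g f : f \notin face_supp (face_of g) ->
  face_mul (face_of g) (face_of f) != face_mul (face_of g) (face_opp (face_of f)).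
Proof.
apply: contraNneq => e; apply/face_supp_face_of => x y gxy.
have /setP/(_ (x, y)) := e; have /setP/(_ (y, x)) := e.
rewrite !in_face_mul_face_of gxy eqxx ltxx /= !inE /swap /=.
by case: ltgtP.
Qed.

(** The span of [H] is that of [G] plus the line of [f1], so modulo the span of
    [G] a point of it is zero, a positive or a negative multiple of [f1]. *)
Lemma two_sides g f1 f :
  let G := face_of g in let H := face_mul G (face_of f1) in
  face_rank H = (face_rank G).+1 ->
  (face_mul H (face_of f) == H)%:R =
  (face_mul G (face_of f) == G)%:R + (face_mul G (face_of f) == H)%:R
   + (face_mul G (face_of f) == face_mul G (face_opp (face_of f1)))%:R :> rat.
Proof.
move=> G H rkH.
have [h eH] : is_face H by apply: is_face_mul; [exists g|exists f1].
have nf1 : f1 \notin face_supp G.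
  by rewrite -face_mul_fix_supp; apply: contraPneq rkH => e; rewrite /H e; exact: n_Sn.
have supH : (face_supp G <= face_supp H)%VS := face_supp_face_mull _ _.
have f1H : f1 \in face_supp H by apply: (subvP (face_supp_face_mulr _ _)); exact: face_supp_self.
have spanH : face_supp H = (face_supp G + <[f1]>)%VS.
  apply/esym/eqP; rewrite eqEdim subv_add supH -memvE f1H /= -/(face_rank H) rkH.
  rewrite ltnNge; apply: contra nf1 => le.
  have /eqP -> : face_supp G == (face_supp G + <[f1]>)%VS by rewrite eqEdim addvSl.
  by rewrite -{1}[f1]add0r memv_add ?mem0v ?memv_line.
have nGH : G != H by apply: contraPneq rkH => <-; exact: n_Sn.
have nGH' : G != face_mul G (face_opp (face_of f1)).
  rewrite eq_sym -face_of_opp face_mul_fix_supp.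
  by rewrite memvN.
have nHH' := face_mul_face_opp_neq nf1.
have inH : (face_mul H (face_of f) == H) = (f \in face_supp H) by rewrite eH face_mul_fix_supp.
rewrite inH -[face_mul G _ == G]/(face_mul (face_of g) (face_of f) == face_of g).
rewrite face_mul_fix_supp.
have [fG|nfG] := boolP (f \in face_supp (face_of g)).
  have /eqP -> : face_mul G (face_of f) == G by rewrite face_mul_fix_supp.
  by rewrite (subvP supH) // (negbTE nGH) (negbTE nGH') !addr0.
have [eF|nF] := eqVneq (face_mul G (face_of f)) H.
  have fH : f \in face_supp H by rewrite -eF (subvP (face_supp_face_mulr _ _) _ (face_supp_self _)).
  by rewrite fH eF (negbTE nHH') add0r addr0.
have [eF|nF'] := eqVneq (face_mul G (face_of f)) (face_mul G (face_opp (face_of f1))).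
  rewrite -(face_supp_face_mul_opp G (face_of f1)) -eF.
  by rewrite (subvP (face_supp_face_mulr _ _) _ (face_supp_self _)) !add0r.
rewrite !add0r; case: (boolP (f \in face_supp H)) => // fH; exfalso.
have := fH; rewrite spanH => /memv_addP[u uG [_ /vlineP[c ->] ef]].
have [c0|c0|c0] := ltgtP c 0.
- case/eqP: nF'; rewrite ef addrC -[c]opprK scaleNr -scalerN -face_of_opp.
  by rewrite face_mul_face_scale // oppr_gt0.
- by case/eqP: nF; rewrite ef addrC face_mul_face_scale.
- by case/negP: nfG; rewrite ef c0 scale0r addr0.
Qed.

End Supports.

(** * The radical and the upper bound *)

Section DescentRadical.
Variables (n : nat) (gT : finGroupType) (S : {set gT}) (B : typeB_action n S).
Local Notation pt := 'rV[rat]_n.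
Local Notation sidx := (signed_index n).
Local Notation s := (gen B).
Local Notation point_act := (point_act B).
Local Notation index_act := (index_act B).
Local Notation rho := (rho n).
Local Notation face := {set sidx * sidx}.
Local Notation chamber := (chamber B).
Local Notation face_act := (face_act B).
Local Notation coefs := (coefs (signed_index n)).
Local Notation invariant_coefs := (invariant_coefs B).
Local Notation Psi := (Psi B).
Implicit Types (u v : pt) (x y : sidx) (i j : 'I_n) (w g h : gT) (F G H K : face).
Implicit Types (a b : coefs).

Lemma index_act_gen i x : index_act (s i) x = reflect_index i x.
Proof. by rewrite /index_act signed_permV signed_perm_gen spermV permE. Qed.

(** Conjugating the sign change of coordinate [0] by simple transpositions. *)
Lemma sign_flip_exists (k : 'I_n) : exists g,
  forall i (b : bool), index_act g (i, b) = (i, b (+) (i == k)).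
Proof.
have [m] := ubnP (k : nat); elim: m k => // m IH k km.
have [k0|k0] := eqVneq (k : nat) 0%N.
  by exists (s k) => i b; rewrite index_act_gen /reflect_index k0.
have [|g hg] := IH (opred k); first by rewrite /=; lia.
exists (s k * g * s k)%g => i b; rewrite !index_actM !index_act_gen /reflect_index (negbTE k0) /=.
rewrite hg /= tpermK; congr (_, _ (+) _).
by rewrite -[in RHS](inj_eq (@perm_inj _ (tperm k (opred k)))) tpermL.
Qed.

Lemma minus_one_exists : exists g, forall x, index_act g x = neg x.
Proof.
suff [g hg] : exists g, forall i (b : bool), index_act g (i, b) = (i, b (+) (i < n)%N).
  by exists g => -[i b]; rewrite hg ltn_ord addbT.
suff flips m : (m <= n)%N -> exists g,
    forall i (b : bool), index_act g (i, b) = (i, b (+) (i < m)%N).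
  exact: flips.
elim: m => [|m IH] mn.
  by exists 1%g => i b; rewrite index_act1 ltn0 addbF.
have [g hg] := IH (ltnW mn); have [t ht] := sign_flip_exists (Ordinal mn).
exists (g * t)%g => i b; rewrite index_actM ht hg -addbA; congr (_, _ (+) _).
by rewrite -val_eqE /= ltnS; case: ltngtP.
Qed.

Lemma point_act_minus_one : exists g, forall v, point_act v g = - v.
Proof.
have [g hg] := minus_one_exists; exists g => v.
by apply: ext_inj => x; rewrite ext_point_act hg ext_neg ext_opp.
Qed.

Definition radical_coefs a := invariant_coefs a /\ forall K, chi K a = 0.

(** In the flat of [G] the sum is a value of a character. One dimension higher,
    [two_sides] writes [chi H a] as [chi G a] plus the sums for the two sides,
    which are equal by the symmetry [-1]; so twice the sum vanishes. *)
Lemma rank_step a G H : radical_coefs a -> is_face G -> (face_rank H < (face_rank G).+2)%N ->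
  \sum_F (face_mul G F == H)%:R * a F = 0.
Proof.
move=> [[a1 a2] chi0] [g ->] rkH; set G0 := face_of g in rkH *.
have [[F1 [aF1 eF1]]|nex] := pselect (exists F, a F != 0 /\ face_mul G0 F = H); last first.
  rewrite big1 // => F _; have [->|aF] := eqVneq (a F) 0; first by rewrite mulr0.
  by case: eqP => [e|_]; [case: nex; exists F|rewrite mul0r].
have [f1 ef1] := a2 _ aF1; rewrite {F1 aF1}ef1 in eF1; subst H.
have supGH := face_supp_face_mull G0 (face_of f1).
have := dimvS supGH; rewrite -/(face_rank _) -/(face_rank _) leq_eqVlt => /orP[/eqP erk|lt].
  have -> : face_mul G0 (face_of f1) = G0.
    apply/eqP; rewrite face_mul_fix_supp.
    have /eqP -> : face_supp G0 == face_supp (face_mul G0 (face_of f1)).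
      by rewrite eqEdim supGH -/(face_rank _) -/(face_rank G0) erk /=.
    by apply: (subvP (face_supp_face_mulr _ _)); exact: face_supp_self.
  exact: chi0.
have erk : face_rank (face_mul G0 (face_of f1)) = (face_rank G0).+1.
  by apply/eqP; rewrite eqn_leq -ltnS rkH.
set H := face_mul G0 _ in erk *; set H' := face_mul G0 (face_opp (face_of f1)).
have opp : \sum_F (face_mul G0 F == H')%:R * a F = \sum_F (face_mul G0 F == H)%:R * a F.
  have [z hz] := point_act_minus_one.
  rewrite (reindex_inj (@face_act_inj _ _ _ B z)) /=; apply: eq_bigr => F _.
  rewrite a1; have [->|/a2[f ->]] := eqVneq (a F) 0; first by rewrite !mulr0.
  by rewrite -face_of_point_act hz face_of_opp face_mul_opp_inj.
have := chi0 H; rewrite /chi.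
have -> : \sum_F (face_mul H F == H)%:R * a F =
  \sum_F (face_mul G0 F == G0)%:R * a F + \sum_F (face_mul G0 F == H)%:R * a F
   + \sum_F (face_mul G0 F == H')%:R * a F.
  rewrite -!big_split; apply: eq_bigr => F _ /=.
  have [->|/a2[f ->]] := eqVneq (a F) 0; first by rewrite !mulr0 !addr0.
  by rewrite two_sides // !mulrDl.
rewrite opp -/(chi G0 a) chi0 add0r => e; lra.
Qed.

Definition rank_ge r a := forall F, a F != 0 -> (r <= face_rank F)%N.

Lemma conv_rank_ge r b a : invariant_coefs b -> radical_coefs a -> rank_ge r b ->
  rank_ge r.+2 (conv b a).
Proof.
move=> [_ b2] ra rb H; apply: contraNT; rewrite -ltnNge => lt; apply/eqP.
rewrite /conv big1 // => G _.
have -> : \sum_(F | face_mul G F == H) b G * a F =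
    b G * \sum_F (face_mul G F == H)%:R * a F.
  rewrite mulr_sumr big_mkcond; apply: eq_bigr => F _.
  by case: (_ == _); rewrite ?mul1r // mul0r mulr0.
have [->|bG] := eqVneq (b G) 0; first by rewrite mul0r.
rewrite rank_step ?mulr0 //; first exact: b2.
by apply: leq_trans lt _; rewrite !ltnS rb.
Qed.

(** Multiplying the unit, which has rank zero, by [a]. *)
Lemma radical_coefs_rank a : radical_coefs a -> rank_ge 2 a.
Proof.
move=> ra; rewrite -[a]conv1; apply: conv_rank_ge => //.
exact: invariant1.
Qed.

(** A combination of faces of full rank is a multiple of the sum of all
    chambers, on which the character of the whole space is not zero. *)
Lemma radical_coefs_top a : radical_coefs a -> rank_ge n a -> forall F, a F = 0.
Proof.
move=> [[a1 a2] chi0] rn.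
have cF F : a F != 0 -> exists w, F = chamber w.
  move=> aF; have [v eF] := a2 F aF; rewrite eF; apply: (chamber_exists B) => x y e.
  have sv : face_supp F = fullv.
    by apply/eqP; rewrite eqEdim subvf dimvf /= /dim /= mul1n rn.
  have : rho \in face_supp F by rewrite sv memvf.
  by rewrite eF => /face_supp_face_of/(_ x y e)/ext_rho_inj.
have cst w : a (chamber w) = a (chamber 1%g) by rewrite -[w]mul1g -chamber_act a1.
have [a0 F|nz] := eqVneq (a (chamber 1%g)) 0.
  by apply/eqP; apply: contraT => aF; have [w eF] := cF F aF; rewrite eF cst a0 in aF.
exfalso; have := chi0 (chamber 1%g); rewrite /chi.
have -> : \sum_F (face_mul (chamber 1%g) F == chamber 1%g)%:R * a F =
    \sum_F (a F != 0)%:R * a (chamber 1%g).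
  apply: eq_bigr => F _; have [->|aF] := eqVneq (a F) 0; first by rewrite mulr0 mul0r.
  have [w ->] := cF F aF; rewrite cst; congr ((nat_of_bool _)%:R * _).
  rewrite chamber1 face_mul_fix_face_of.
  by do 2 (apply/forallP => ?); apply/implyP => /eqP/ext_rho_inj ->.
rewrite -mulr_suml => /eqP; rewrite mulf_eq0 (negbTE nz) orbF.
rewrite psumr_eq0 => [/allP h|F _]; last first.
  exact: ler0n.
have := h (chamber 1%g) (mem_index_enum _); by rewrite nz.
Qed.

Lemma Psi_inj a b : invariant_coefs a -> invariant_coefs b -> Psi a = Psi b -> a = b.
Proof.
move=> ia ib e; apply/funext => F.
have := Psi_faithful (invariant_lincomb (-1) ib ia).
rewrite Psi_lincomb e scaleN1r addNr => /(_ erefl F).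
by rewrite /lincomb mulN1r addrC => /subr0_eq.
Qed.

Local Notation A := (descent_algebra S).

(** Filtration of the radical by the rank of the faces that occur. *)
Definition rank_part r (z : group_alg rat gT) :=
  exists a, [/\ radical_coefs a, rank_ge r a & z = Psi a].

Lemma radical_coefs_lincomb k a b :
  radical_coefs a -> radical_coefs b -> radical_coefs (lincomb k a b).
Proof.
move=> [ia ha] [ib hb]; split=> [|K]; first exact: invariant_lincomb.
by rewrite chi_lincomb ha hb mulr0 addr0.
Qed.

Lemma rank_part_lin r : lin_closed (rank_part r).
Proof.
split.
  exists (fun=> 0); split; last by rewrite Psi0.
    split; first exact: invariant0.
    by move=> K; rewrite /chi big1 // => F _; rewrite mulr0.
  by move=> F; rewrite eqxx.
move=> k _ _ [a [ra na ->]] [b [rb nb ->]]; exists (lincomb k a b).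
split; [exact: radical_coefs_lincomb| |by rewrite Psi_lincomb].
move=> F; rewrite /lincomb; have [a0|/na //] := eqVneq (a F) 0.
by rewrite a0 mulr0 add0r => /nb.
Qed.

Definition rank_space r := vspace_of (rank_part_lin r).

Lemma rank_space_top r : (n <= r)%N -> rank_space r = 0%VS.
Proof.
move=> nr; apply/eqP; rewrite -subv0; apply/subvP => z /memv_of[a [ra rka ->]].
have a0 : a = (fun=> 0).
  apply/funext; apply: radical_coefs_top => // F /rka; exact: leq_trans.
by rewrite a0 Psi0 mem0v.
Qed.

Lemma mem_rank_space z :
  z \in rank_space 2 <-> exists2 a, radical_coefs a & z = Psi a.
Proof.
split=> [/memv_of[a [ra _ ->]]|[a ra ->]]; first by exists a.
by apply/memv_of; exists a; split=> //; exact: radical_coefs_rank.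
Qed.

Lemma rank_space_mul r : (rank_space 2 * rank_space r <= rank_space r.+2)%VS.
Proof.
apply/prodvP => _ _ /mem_rank_space[a ra ->] /memv_of[b [rb nb ->]].
apply/memv_of; exists (conv b a); split.
- split=> [|K]; first exact: invariant_conv rb.1 ra.1.
  by rewrite chi_conv ra.2 mulr0.
- exact: conv_rank_ge rb.1 ra nb.
- by rewrite Psi_conv //; exact: ra.1.
Qed.

Lemma rank_space_exp k : (rank_space 2 ^+ k.+1 <= rank_space (k.+1).*2)%VS.
Proof.
elim: k => [|k IH]; first by rewrite expv1.
by rewrite expvSl (subv_trans (prodvSr _ IH)) // rank_space_mul.
Qed.

Lemma rank_space_sub : (rank_space 2 <= A)%VS.
Proof.
by apply/subvP => z /mem_rank_space[a [ia _] ->]; apply/(descent_algebraP B); exists a.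
Qed.

Lemma one_in_descent : 1 \in A.
Proof.
by apply/(descent_algebraP B); exists (one_coefs (T := sidx)); [exact: invariant1|rewrite Psi1].
Qed.

Definition chi_part K (z : group_alg rat gT) :=
  exists a, [/\ invariant_coefs a, chi K a = 0 & z = Psi a].

Lemma chi_part_lin K : lin_closed (chi_part K).
Proof.
split.
  exists (fun=> 0); split; [exact: invariant0| |by rewrite Psi0].
  by rewrite /chi big1 // => F _; rewrite mulr0.
move=> k _ _ [a [ra na ->]] [b [rb nb ->]]; exists (lincomb k a b).
split; [exact: invariant_lincomb| |by rewrite Psi_lincomb].
by rewrite chi_lincomb na nb mulr0 addr0.
Qed.

(** The kernel of a character with values in the base field has codimension
    one; it is proper because [Psi] is injective. *)
Lemma chi_maximal K : maximal_left_ideal A (vspace_of (chi_part_lin K)).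
Proof.
set M := vspace_of _; split.
- apply/andP; split; first apply/subvP => z /memv_of[a [ia _ ->]].
    by apply/(descent_algebraP B); exists a.
  apply/prodvP => _ _ /(descent_algebraP B)[a ia ->] /memv_of[b [ib hb ->]].
  apply/memv_of; exists (conv b a); split; first exact: invariant_conv.
    by rewrite chi_conv hb mul0r.
  by rewrite Psi_conv.
- apply: contraTneq one_in_descent => <-; apply/negP => /memv_of[a [ia ha e]].
  have ea : one_coefs (T := sidx) = a.
    by apply: Psi_inj => //; [exact: invariant1|rewrite Psi1].
  by have := chi1 K; rewrite ea ha => /eqP; rewrite eq_sym oner_eq0.
move=> L /andP[LA _] ML.
have [LM|nLM] := boolP (L <= M)%VS.
  by left; apply/eqP; rewrite eqEsubv LM ML.
right; apply/eqP; rewrite eqEsubv LA; have [y yL nyM] := subvPn nLM.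
have [b ib ey] := (descent_algebraP B y).1 (subvP LA y yL).
have cb : chi K b != 0.
  by apply: contraNneq nyM => hb; apply/memv_of; exists b.
apply/subvP => z /(descent_algebraP B)[a ia ez].
have zM : - (chi K a / chi K b) *: y + z \in M.
  apply/memv_of; exists (lincomb (- (chi K a / chi K b)) b a); split.
  - exact: invariant_lincomb.
  - by rewrite chi_lincomb mulNr divfK // addNr.
  - by rewrite Psi_lincomb ey ez.
have := memvD (memvZ (chi K a / chi K b) yL) (subvP ML _ zM).
by rewrite addrA -scalerDl subrr scale0r add0r.
Qed.

(** The rank filtration makes this ideal nilpotent, and the kernels of the
    characters are maximal left ideals with this intersection. *)
Lemma descent_radical : jacobson_radical A = rank_space 2.
Proof.
apply: jacobson_radicalP.
- exact: one_in_descent.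
- exact: rank_space_sub.
- apply/prodvP => _ _ /(descent_algebraP B)[a ia ->] /mem_rank_space[b [ib hb] ->].
  apply/mem_rank_space; exists (conv b a); last by rewrite Psi_conv.
  by split=> [|K]; [exact: invariant_conv|rewrite chi_conv hb mul0r].
- move=> z zR; exists n.+1; apply/eqP; rewrite -memv0.
  have <- : rank_space (n.+1).*2 = 0%VS by apply: rank_space_top; lia.
  apply: (subvP (rank_space_exp n)); elim: (n) => [|m IH].
    by rewrite expr1 expv1.
  by rewrite exprS expvSl memv_mul.
move=> z /(descent_algebraP B)[a ia ez] nz.
have [K cK] : exists K, chi K a != 0.
  apply: contrapT => h; case/negP: nz; apply/mem_rank_space; exists a => //.
  split=> // K; apply/eqP; apply: contraT => cK; case: h; by exists K.
exists (vspace_of (chi_part_lin K)); first exact: chi_maximal.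
apply/negP => /memv_of[b [ib hb e]]; case/eqP: cK.
by rewrite (Psi_inj ia ib) // -ez.
Qed.

Lemma radical_exp0 k : (0 < k)%N -> (n <= k.*2)%N -> (jacobson_radical A ^+ k)%VS = 0%VS.
Proof.
case: k => // k _ nk; rewrite descent_radical; apply/eqP; rewrite -subv0.
by rewrite (subv_trans (rank_space_exp k)) // rank_space_top.
Qed.

End DescentRadical.

(** * Faces with one large block *)

Section BlockPoints.
Variable n : nat.
Local Notation pt := 'rV[rat]_n.
Local Notation sidx := (signed_index n).
Local Notation face := {set sidx * sidx}.
Implicit Types (u v f g : pt) (x y : sidx) (F G H : face) (p q : nat) (k m : 'I_n).

(** The first [p] coordinates are singletons with values [1, ..., p] and the
    others form a block with the value [p + 1]. *)
Definition block_last p : pt := \row_(k < n) (minn k p).+1%:R.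
(** The same blocks as for [block_last], with the large one moved from the
    outermost to the innermost position. *)
Definition block_first p : pt := \row_(k < n) (if (k < p)%N then k.+2 else 1%N)%:R.

Lemma ext_natE (v : pt) (c : 'I_n -> nat) x y :
  (forall k, v 0 k = (c k).+1%:R) ->
  (ext v x == ext v y) = (x.2 == y.2) && (c x.1 == c y.1).
Proof.
move=> h; rewrite /ext !h.
have hx : 0 < (c x.1).+1%:R :> rat by rewrite ltr0n.
have hy : 0 < (c y.1).+1%:R :> rat by rewrite ltr0n.
rewrite -eqSS -(eqr_nat rat).
case: x.2; case: y.2; rewrite /= ?expr0 ?expr1 ?mulN1r ?mul1r ?eqr_opp //; apply/eqP; lra.
Qed.

Lemma block_last_coord p k : block_last p 0 k = (minn k p).+1%:R.
Proof. by rewrite mxE. Qed.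

Lemma block_first_coord p k : block_first p 0 k = (if (k < p)%N then k.+1 else 0%N).+1%:R.
Proof. by rewrite mxE; case: ifP. Qed.

Lemma block_kernel p x y :
  (ext (block_first p) x == ext (block_first p) y) =
  (ext (block_last p) x == ext (block_last p) y).
Proof.
rewrite (ext_natE _ _ (block_first_coord p)) (ext_natE _ _ (block_last_coord p)).
congr (_ && _); case: ltnP => hx; case: ltnP => hy; lia.
Qed.

(** Lying in the flat of [K] depends only on the ties of a point. *)
Lemma face_mul_fix_kernel (K : face) u v :
  (forall x y, (ext u x == ext u y) = (ext v x == ext v y)) ->
  (face_mul K (face_of u) == K) = (face_mul K (face_of v) == K).
Proof.
move=> e.
have h u' v' : (forall x y, (ext u' x == ext u' y) = (ext v' x == ext v' y)) ->
    face_mul K (face_of u') == K -> face_mul K (face_of v') == K.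
  move=> e' /face_mul_fixP hu; apply/face_mul_fixP => -[x y] h1 h2.
  have := hu (x, y) h1 h2; have := hu (y, x) h2 h1; rewrite !in_face_of -!leNgt => le1 le2.
  have : ext v' x == ext v' y by rewrite -e' eq_le le1 le2.
  by move=> /eqP ->.
by apply/idP/idP; apply: h.
Qed.

Lemma pos_face_eq u v :
  (forall k, 0 < u 0 k) -> (forall k, 0 < v 0 k) ->
  (forall k m, (u 0 k < u 0 m) = (v 0 k < v 0 m)) -> face_of u = face_of v.
Proof.
move=> pu pv e; apply/setP => -[[k b] [m c]]; rewrite !in_face_of /ext /=.
have := e k m; have := e m k.
have := pu k; have := pu m; have := pv k; have := pv m.
case: b; case: c; rewrite /= ?expr0 ?expr1 ?mulN1r ?mul1r ?ltrN2 // => *;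
  apply/idP/idP; lra.
Qed.

(** Two more coordinates leave the large block. *)
Lemma face_rank_block_last p q : p = q.+2 -> (p.+2 <= n)%N ->
  (face_rank (face_of (block_last p)) <= (face_rank (face_of (block_last q))).+2)%N.
Proof.
move=> -> pn.
have hz : (n.-1 < n)%N by lia.
have hq : (q < n)%N by lia.
have hq1 : (q.+1 < n)%N by lia.
pose z := Ordinal hz; pose i := Ordinal hq; pose j := Ordinal hq1.
pose di : pt := delta_mx 0 i; pose dj : pt := delta_mx 0 j.
(* [z] is in the large block; the corrections give the coordinates [q] and
   [q + 1] its value. *)
have sub : (face_supp (face_of (block_last q.+2)) <=
   face_supp (face_of (block_last q)) + <[di]> + <[dj]>)%VS.
  apply/subvP => u /face_supp_face_of hu.
  have cst k m : (q.+2 <= k)%N -> (q.+2 <= m)%N -> u 0 k = u 0 m.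
    move=> hk hm; have := hu (k, false) (m, false).
    rewrite /ext /= !expr0 !mul1r; apply; rewrite !block_last_coord; congr (_%:R); lia.
  pose c := u 0 i - u 0 z; pose d := u 0 j - u 0 z.
  have -> : u = (u - c *: di - d *: dj) + c *: di
               + d *: dj.
    by rewrite [RHS]addrAC !subrK.
  rewrite !memv_add ?memvZ ?memv_line //.
  apply/face_supp_face_of => x y /eqP; rewrite (ext_natE _ _ (block_last_coord q)).
  move=> /andP[/eqP e1 /eqP e2]; rewrite /ext e1; congr (_ * _).
  have [xy|nxy] := eqVneq x.1 y.1; first by rewrite xy.
  have {nxy} nxy : x.1 != y.1 :> nat by [].
  have val k : (q <= k)%N -> (u - c *: di - d *: dj) 0 k = u 0 z.
    move=> hk; rewrite !mxE eqxx /= -!val_eqE /=.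
    have [kq|kq] := eqVneq (k : nat) q.
      have -> : k = i by apply: val_inj.
      by rewrite /= (ltn_eqF (ltnSn q)) /c /=; ring.
    have [kq1|kq1] := eqVneq (k : nat) q.+1.
      have -> : k = j by apply: val_inj.
      by rewrite /d /=; ring.
    rewrite (cst k z) ?/=; [ring|lia..].
  by rewrite !val //; lia.
apply: leq_trans (dimvS sub) _.
have add1 (U : {vspace pt}) d : (\dim (U + <[d]>) <= (\dim U).+1)%N.
  apply: leq_trans (dimv_add_leqif _ _) _.
  by rewrite -[(\dim U).+1]addn1 leq_add2l dim_vline leq_b1.
by apply: leq_trans (add1 _ _) _; rewrite ltnS add1.
Qed.

End BlockPoints.

Section LowerBound.
Variables (n : nat) (gT : finGroupType) (S : {set gT}) (B : typeB_action n S).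
Local Notation pt := 'rV[rat]_n.
Local Notation sidx := (signed_index n).
Local Notation s := (gen B).
Local Notation point_act := (point_act B).
Local Notation index_act := (index_act B).
Local Notation rho := (rho n).
Local Notation face := {set sidx * sidx}.
Local Notation face_act := (face_act B).
Local Notation coefs := (coefs (signed_index n)).
Local Notation invariant_coefs := (invariant_coefs B).
Local Notation radical_coefs := (radical_coefs B).
Local Notation Psi := (Psi B).
Local Notation f_ := (@block_last n).
Local Notation f'_ := (@block_first n).
Implicit Types (u v : pt) (x y : sidx) (k m : 'I_n) (w g h : gT) (F G H K : face).
Implicit Types (a b : coefs) (p q j : nat).

Lemma point_act_coord w : exists (t : 'I_n -> 'I_n) (e : 'I_n -> bool), injective t /\
  forall v k, point_act v w 0 k = (-1) ^+ e k * v 0 (t k).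
Proof.
exists (fun k => (index_act w (k, false)).1), (fun k => (index_act w (k, false)).2); split.
  move=> k m; case ek: (index_act w (k, false)) => [k' b].
  case em: (index_act w (m, false)) => [m' c] /=.
  move=> e; subst m'; have [e|ne] := eqVneq b c.
    by have [] : (k, false) = (m, false) by apply: (@index_act_inj _ _ _ B w); rewrite ek em e.
  suff: (k, false) = neg (m, false) by [].
  apply: (@index_act_inj _ _ _ B w); rewrite index_act_neg ek em /neg /=.
  by case: b c ne {ek em} => [] [].
by move=> v k; have := ext_point_act B v w (k, false); rewrite {1}/ext /= expr0 mul1r.
Qed.

Lemma face_rank_act v w : face_rank (face_of (point_act v w)) = face_rank (face_of v).
Proof.
have lin g : linear (fun u : pt => point_act u g).
  move=> c u u'; apply: ext_inj => x.
  by rewrite ext_lin !ext_point_act ext_lin.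
pose L g : pt -> pt := fun u => point_act u g.
have le v' g : (face_rank (face_of v') <= face_rank (face_of (point_act v' g)))%N.
  pose Lg := GRing.isLinear.Build rat pt pt *:%R (L g) (lin g).
  pose f : {linear pt -> pt} := HB.pack (L g) Lg.
  have kf : (face_supp (face_of v') :&: lker (linfun f) = 0)%VS.
    apply/eqP; rewrite -subv0; apply/subvP => u; rewrite memv_cap memv_ker lfunE memv0 /=.
    case/andP=> _ /eqP e; apply/eqP.
    rewrite -[u](point_act1 B) -(mulgV g) point_actM -/(L g u) e.
    by apply: ext_inj => x; rewrite ext_point_act !ext0.
  rewrite /face_rank -(limg_dim_eq kf) dimvS //.
  apply/subvP => _ /memv_imgP[u /face_supp_face_of hu ->].
  rewrite lfunE /=; apply/face_supp_face_of => x y.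
  by rewrite !ext_point_act; exact: hu.
apply/eqP; rewrite eqn_leq le andbT.
by have := le (point_act v w) w^-1%g; rewrite -point_actM mulgV point_act1.
Qed.

(** Both orbits have stabilizers of the same order, so summing over the group
    only rescales the difference of the two orbit sums. *)
Definition block_diff p : coefs := fun F =>
  \sum_w ((F == face_of (point_act (f_ p) w))%:R - (F == face_of (point_act (f'_ p) w))%:R).

Lemma block_diffE p F : block_diff p F =
  \sum_w ((F == face_of (point_act (f_ p) w))%:R - (F == face_of (point_act (f'_ p) w))%:R).
Proof. by []. Qed.

Lemma sum_block_diff (c : coefs) p : \sum_F c F * block_diff p F =
  \sum_w (c (face_of (point_act (f_ p) w)) - c (face_of (point_act (f'_ p) w))).
Proof.
under eq_bigr => F _ do rewrite /block_diff mulr_sumr.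
rewrite exchange_big /=; apply: eq_bigr => w _.
have one v : \sum_F c F * (F == face_of v)%:R = c (face_of v).
  rewrite (bigD1 (face_of v)) //= eqxx mulr1 big1 ?addr0 // => F /negbTE ->.
  by rewrite mulr0.
by under eq_bigr => F _ do rewrite mulrBr; rewrite sumrB !one.
Qed.

Lemma block_diff_neq0 p F : block_diff p F != 0 ->
  exists w, F = face_of (point_act (f_ p) w) \/ F = face_of (point_act (f'_ p) w).
Proof.
move=> nz; apply: contrapT => h; case/eqP: nz; rewrite /block_diff big1 // => w _.
case: eqP => [e|_]; first by case: h; exists w; left.
case: eqP => [e|_]; first by case: h; exists w; right.
by rewrite subrr.
Qed.

Lemma point_act_block_kernel p w x y :
  (ext (point_act (f'_ p) w) x == ext (point_act (f'_ p) w) y) =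
  (ext (point_act (f_ p) w) x == ext (point_act (f_ p) w) y).
Proof. by rewrite !ext_point_act block_kernel. Qed.

(** Both kinds of faces have the same ties, so no character separates them. *)
Lemma block_diff_radical p : radical_coefs (block_diff p).
Proof.
split.
  split=> [F g|F /block_diff_neq0[w [->|->]]]; last 2 first.
  - by exists (point_act (f_ p) w).
  - by exists (point_act (f'_ p) w).
  rewrite /block_diff (reindex_inj (mulIg g)) /=; apply: eq_bigr => w _.
  have act_eq F1 F2 : (face_act F1 g == face_act F2 g) = (F1 == F2).
    exact: inj_eq (@face_act_inj _ _ _ B g) F1 F2.
  by rewrite !face_of_point_act !face_actM !act_eq.
move=> K; rewrite /chi (sum_block_diff (fun F => (face_mul K F == K)%:R)).
rewrite big1 // => w _; apply/eqP; rewrite subr_eq0; apply/eqP.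
congr (nat_of_bool _)%:R; apply: face_mul_fix_kernel => x y.
by rewrite point_act_block_kernel.
Qed.

Fixpoint block_prod j : coefs :=
  if j is j'.+1 then conv (block_prod j') (block_diff j'.*2.+1) else one_coefs (T := sidx).

Lemma block_prod_invariant j : invariant_coefs (block_prod j).
Proof.
elim: j => [|j IH]; first exact: invariant1.
by apply: invariant_conv IH _; case: (block_diff_radical j.*2.+1).
Qed.

(** An injection maps a finite set of indices into itself only if it preserves
    its complement too. *)
Lemma perm_upper_set (t : 'I_n -> 'I_n) p : injective t ->
  (forall k, (p <= k)%N -> (p <= t k)%N) -> forall k, (p <= t k)%N = (p <= k)%N.
Proof.
move=> ti h.
have /eqP e : [set k : 'I_n | (p <= k)%N] == t @^-1: [set k : 'I_n | (p <= k)%N].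
  rewrite eqEcard card_preimset // leqnn andbT.
  by apply/subsetP => k; rewrite !inE; exact: h.
by move=> k; have /setP/(_ k) := e; rewrite !inE.
Qed.

(** The preimage of the upper set has the same number of elements and is itself
    an upper set. *)
Lemma perm_upper_set_closed (t : 'I_n -> 'I_n) p : injective t ->
  (forall k m, (k <= m)%N -> (p <= t k)%N -> (p <= t m)%N) ->
  forall k, (p <= t k)%N = (p <= k)%N.
Proof.
move=> ti up; apply: perm_upper_set => // k pk; apply: contraT => ntk.
pose T := [set m : 'I_n | (p <= m)%N]; pose E := t @^-1: T.
have : E \proper T.
  apply/properP; split; last by exists k; rewrite !inE.
  apply/subsetP => m; rewrite !inE => tm; apply: leq_trans pk _.
  by case: (leqP k m) => // /ltnW mk; move: ntk; rewrite (up _ _ mk tm).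
by move=> /proper_card; rewrite card_preimset // ltnn.
Qed.

End LowerBound.

(** * One link of the chain of faces *)

Section Coefficient.
Variables (n : nat) (gT : finGroupType) (S : {set gT}) (B : typeB_action n S).
Local Notation pt := 'rV[rat]_n.
Local Notation sidx := (signed_index n).
Local Notation s := (gen B).
Local Notation point_act := (point_act B).
Local Notation index_act := (index_act B).
Local Notation face := {set sidx * sidx}.
Local Notation block_diff := (block_diff B).
Local Notation f_ := (@block_last n).
Local Notation f'_ := (@block_first n).
Implicit Types (u v : pt) (x y : sidx) (k m : 'I_n) (w g h : gT) (F G H K : face).

Lemma face_mul_pos_face u v (r : pt) :
  (forall k, 0 < u 0 k) -> (forall k, 0 < r 0 k) ->
  (forall k m, (r 0 k < r 0 m) = (u 0 k < u 0 m) || ((u 0 k == u 0 m) && (v 0 k < v 0 m))) ->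
  face_mul (face_of u) (face_of v) = face_of r.
Proof.
move=> pu pr e; apply/setP => -[[k b] [m c]]; rewrite in_face_mul_face_of !in_face_of /ext /=.
have := pu k; have := pu m; have := pr k; have := pr m.
case: b; case: c; rewrite /= ?expr0 ?expr1 ?mulN1r ?mul1r ?ltrN2 ?eqr_opp => a1 a2 a3 a4.
- by rewrite e [u 0 k == _]eq_sym.
- have -> : - u 0 k < u 0 m by lra.
  by apply/esym; lra.
- have -> : (u 0 k < - u 0 m) = false by apply/negbTE; rewrite -leNgt; lra.
  have -> : (u 0 k == - u 0 m) = false by apply/eqP; lra.
  by apply/esym/negbTE; rewrite -leNgt; lra.
- by rewrite e.
Qed.

Lemma block_last_gt0 p k : 0 < f_ p 0 k.
Proof. by rewrite block_last_coord ltr0n. Qed.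

Variables (p q : nat).
Hypotheses (pq : p = q.+2) (pn : (p.+2 <= n)%N).

Fact lt_q : (q < n)%N. Proof. lia. Qed.
Fact lt_q1 : (q.+1 < n)%N. Proof. lia. Qed.
Fact lt_last : (n.-1 < n)%N. Proof. lia. Qed.
Fact lt_last2 : (n.-2 < n)%N. Proof. lia. Qed.
Let i := Ordinal lt_q.
Let j := Ordinal lt_q1.
Let z := Ordinal lt_last.
Let z' := Ordinal lt_last2.

(** Breaking the ties of [block_last q] into those of [block_last p] means that
    the coordinates [q] and [q + 1] leave the block, in this order, before it. *)
Definition splits v :=
  [&& v 0 i < v 0 j, v 0 j < v 0 z & [forall k : 'I_n, (p <= k)%N ==> (v 0 k == v 0 z)]].

Lemma face_mul_splits v :
  (face_mul (face_of (f_ q)) (face_of v) == face_of (f_ p)) = splits v.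
Proof.
apply/eqP/and3P => [e|[ij jz /forallP cst]].
  have h k m : (q <= k)%N -> (q <= m)%N ->
      (v 0 k < v 0 m) = (minn k p < minn m p)%N.
    move=> qk qm; have /setP/(_ ((k, false), (m, false))) := e.
    rewrite in_face_mul_face_of !in_face_of /ext /= !expr0 !mul1r !block_last_coord.
    have -> : minn k q = q by lia.
    have -> : minn m q = q by lia.
    by rewrite ltxx eqxx /= ltr_nat ltnS.
  split; [by rewrite h /=; lia|by rewrite h /=; lia|].
  apply/forallP => k; apply/implyP => pk.
  by rewrite eq_le !leNgt !h /=; lia.
have vk k : (p <= k)%N -> v 0 k = v 0 z by move=> pk; have /implyP/(_ pk)/eqP := cst k.
apply: face_mul_pos_face => [k|k|k m]; [exact: block_last_gt0..|].
rewrite !block_last_coord !ltr_nat eqr_nat !ltnS eqSS.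
have cases (l : 'I_n) : (q <= l)%N ->
    [\/ minn l p = q /\ v 0 l = v 0 i, minn l p = q.+1 /\ v 0 l = v 0 j |
        minn l p = q.+2 /\ v 0 l = v 0 z].
  move=> ql; have [lq|lq] := eqVneq (l : nat) q.
    constructor 1; split; first by lia.
    by congr (v 0 _); apply: val_inj.
  have [lq1|lq1] := eqVneq (l : nat) q.+1.
    constructor 2; split; first by lia.
    by congr (v 0 _); apply: val_inj.
  by constructor 3; split; [lia|apply: vk; lia].
have [lt|le] := ltnP (minn k q) (minn m q); first by rewrite /=; lia.
have [e|ne] /= := eqVneq (minn k q) (minn m q); last by apply/negbTE; lia.
have [/val_inj ->|nkm] := eqVneq (k : nat) m; first by rewrite ltxx ltnn.
have qk : (q <= k)%N by lia.
have qm : (q <= m)%N by lia.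
by case: (cases k qk) => [[-> ->]|[-> ->]|[-> ->]];
   case: (cases m qm) => [[-> ->]|[-> ->]|[-> ->]];
   rewrite ?ltxx ?ltnn //; apply/idP/idP => hh; first [lia | lra].
Qed.

(** Negation followed by the exchange of the coordinates [q] and [q + 1]. *)
Definition turn v : pt := reflect_pt (- v) j.

Lemma turn_coord v k : turn v 0 k = - v 0 (tperm j i k).
Proof.
have := ext_reflect (- v) j (k, false); rewrite /reflect_index /=.
have -> : opred j = i by apply: val_inj.
by rewrite /ext /= !expr0 !mul1r /turn => ->; rewrite mxE.
Qed.

Lemma tpermz k : (p <= k)%N -> tperm j i k = k.
Proof. by move=> pk; rewrite tpermD // -val_eqE /=; lia. Qed.

(** If the large block is innermost and [v'] splits, then the two singletons are
    negative. Moving the block outwards keeps the splitting of [v'] if the block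
    is positive, and turning creates one if it is negative. In both cases the
    two singletons of [turn v'] are positive, beyond the innermost block. *)
Lemma splits_turn w :
  splits (point_act (f'_ p) w) ->
  ~~ splits (turn (point_act (f'_ p) w)) /\
  (splits (point_act (f_ p) w) || splits (turn (point_act (f_ p) w))).
Proof.
have [t [e [ti vt]]] := point_act_coord B w.
set v' := point_act (f'_ p) w; set v := point_act (f_ p) w.
have v'E k : v' 0 k = (-1) ^+ e k * (if (t k < p)%N then (t k).+1 else 0%N).+1%:R.
  by rewrite vt block_first_coord.
have vE k : v 0 k = (-1) ^+ e k * (minn (t k) p).+1%:R by rewrite vt block_last_coord.
move=> /and3P[ij jz /forallP cst].
have v'k k : (p <= k)%N -> v' 0 k = v' 0 z by move=> pk; have /implyP/(_ pk)/eqP := cst k.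
have pz : (p <= z)%N by rewrite /=; lia.
have eqs k m : v' 0 k = v' 0 m -> e k = e m /\
   ((if (t k < p)%N then (t k).+1 else 0%N) = (if (t m < p)%N then (t m).+1 else 0%N)).
  rewrite !v'E; set a := (if _ then _ else _); set b := (if _ then _ else _) => h.
  have ha : 0 < a.+1%:R :> rat by rewrite ltr0n.
  have hb : 0 < b.+1%:R :> rat by rewrite ltr0n.
  case: (e k) (e m) h => -[]; rewrite /= ?expr0 ?expr1 ?mulN1r ?mul1r => h; try (exfalso; lra).
    by split=> //; move/oppr_inj/eqP: h; rewrite eqr_nat eqSS => /eqP.
  by split=> //; move/eqP: h; rewrite eqr_nat eqSS => /eqP.
(* The last two coordinates [z'] and [z] are equal, and only the value of the
   large block is repeated. *)
have tz : (p <= t z)%N.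
  have pz' : (p <= z')%N by rewrite /=; lia.
  rewrite leqNgt; apply/negP => tzp.
  have [_] := eqs _ _ (v'k _ pz'); rewrite tzp; case: ifP => // _ [et].
  have := ti _ _ (ord_inj et) => /(congr1 (@nat_of_ord n)) /=; lia.
have tp := perm_upper_set ti (p := p).
have {}tp k : (p <= t k)%N = (p <= k)%N.
  apply: tp => m pm; have [_] := eqs _ _ (v'k _ pm).
  by rewrite (ltnNge (t z)) tz /=; case: ltnP.
have ez k : (p <= k)%N -> e k = e z by move=> /v'k/eqs[].
have vz k : (p <= k)%N -> v 0 k = v 0 z.
  by move=> pk; rewrite !vE (ez _ pk) !(minn_idPr _) // tp.
have v'z : v' 0 z = (-1) ^+ e z by rewrite v'E ltnNge tz /= mulr1.
have vzE : v 0 z = (-1) ^+ e z * p.+1%:R by rewrite vE (minn_idPr tz).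
have small k : (k < p)%N -> exists a : nat, [/\ (a < p)%N, v' 0 k = (-1) ^+ e k * a.+2%:R &
    v 0 k = (-1) ^+ e k * a.+1%:R].
  move=> kp; have tk : (t k < p)%N by rewrite ltnNge tp -ltnNge.
  exists (t k); split=> //; first by rewrite v'E tk.
  by rewrite vE (minn_idPl (ltnW tk)).
have hip : (i < p)%N by rewrite /=; lia.
have hjp : (j < p)%N by rewrite /=; lia.
have [a [ap v'i vi]] := small i hip.
have [b [bp v'j vj]] := small j hjp.
have tur u : [/\ turn u 0 i = - u 0 j, turn u 0 j = - u 0 i &
    forall k, (p <= k)%N -> turn u 0 k = - u 0 k].
  by split; rewrite ?turn_coord ?tpermL ?tpermR // => k pk; rewrite turn_coord tpermz.
have [t1 t2 t3] := tur v'; have [s1 s2 s3] := tur v.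
have ar : 0 <= a%:R :> rat by rewrite ler0n.
have br : 0 <= b%:R :> rat by rewrite ler0n.
have pr : a%:R + 1 <= p%:R :> rat by rewrite natr1 ler_nat.
have qr : b%:R + 1 <= p%:R :> rat by rewrite natr1 ler_nat.
have nat2 (c : nat) : c.+2%:R = c%:R + 2 :> rat by rewrite -addn2 natrD.
have nat1 (c : nat) : c.+1%:R = c%:R + 1 :> rat by rewrite -addn1 natrD.
rewrite (nat2 a) in v'i; rewrite (nat1 a) in vi; rewrite (nat2 b) in v'j.
rewrite (nat1 b) in vj; rewrite (nat1 p) in vzE.
rewrite v'i v'j in ij; rewrite v'j v'z in jz.
split.
  apply/negP => /and3P[c1 c2 _]; move: c1 c2; rewrite t1 t2 t3 // v'i v'j v'z.
  move: ij jz; clear - ar br pr qr; case: (e i); case: (e j); case: (e z);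
    rewrite /= ?expr0 ?expr1 ?mulN1r ?mul1r => *; lra.
have cz : [forall k : 'I_n, (p <= k)%N ==> (v 0 k == v 0 z)].
  by apply/forallP => k; apply/implyP => /vz ->.
have ct : [forall k : 'I_n, (p <= k)%N ==> (turn v 0 k == turn v 0 z)].
  by apply/forallP => k; apply/implyP => pk; rewrite !s3 // vz.
rewrite /splits cz ct !andbT s1 s2 s3 // vi vj vzE.
move: ij jz; clear - ar br pr qr => ij; case: (e z);
  rewrite /= ?expr0 ?expr1 => jz; apply/orP; [right|left];
  move: ij jz; case: (e i); case: (e j);
    rewrite /= ?expr0 ?expr1 ?mulN1r ?mul1r => *; apply/andP; split; lra.
Qed.

Lemma splits_turn_le w :
  (splits (point_act (f'_ p) w) + splits (turn (point_act (f'_ p) w)) <=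
   splits (point_act (f_ p) w) + splits (turn (point_act (f_ p) w)))%N.
Proof.
have [c hc] := point_act_minus_one B.
have turnE v : turn v = point_act v (c * s j)%g by rewrite point_actM hc point_act_gen.
have turnK v : turn (turn v) = v.
  by rewrite /turn; apply: ext_inj => x; rewrite !(ext_reflect, ext_opp) reflect_indexK opprK.
have [h|nh] := boolP (splits (point_act (f'_ p) w)).
  by have [/negbTE ->] := splits_turn h; do 2 case: (splits _).
have [h|//] := boolP (splits (turn (point_act (f'_ p) w))).
have := h; rewrite turnE -point_actM => /splits_turn[_].
by rewrite !(point_actM B _ w) -!turnE !turnK; do 2 case: (splits _).
Qed.

(** Averaging over [w] and its turn makes every summand nonnegative by
    [splits_turn_le]; the summand is positive if the two singletons have opposite
    signs, which happens after changing the sign of coordinate [q]. *)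
Lemma block_inner_gt0 :
  0 < \sum_F (face_mul (face_of (f_ q)) F == face_of (f_ p))%:R * block_diff p F.
Proof.
rewrite (sum_block_diff B (fun F => (face_mul (face_of (f_ q)) F == face_of (f_ p))%:R)).
under eq_bigr => w _ do rewrite !face_mul_splits.
set X := \sum_w _.
have [c hc] := point_act_minus_one B.
have turnE v : turn v = point_act v (c * s j)%g by rewrite point_actM hc point_act_gen.
pose d w : rat := (splits (point_act (f_ p) w))%:R - (splits (point_act (f'_ p) w))%:R
    + ((splits (turn (point_act (f_ p) w)))%:R - (splits (turn (point_act (f'_ p) w)))%:R).
have eX : X + X = \sum_w d w.
  rewrite /d big_split /= -/X; congr (_ + _).
  rewrite /X (reindex_inj (mulIg (c * s j)%g)) /=.
  by apply: eq_bigr => w _; rewrite !turnE -!point_actM.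
have d0 w : 0 <= d w.
  rewrite /d addrACA -opprD -!natrD subr_ge0 ler_nat; exact: splits_turn_le.
suff: 0 < \sum_w d w by rewrite -eX; lra.
have [g hg] := sign_flip_exists B i.
have pg v k : point_act v g 0 k = if k == i then - v 0 k else v 0 k.
  have := ext_point_act B v g (k, false); rewrite hg /ext /= expr0 mul1r => ->.
  by case: eqP => _; rewrite /= ?expr0 ?expr1; ring.
(* Here the two singletons are [- (q + 1)] and [q + 2]. *)
have dg : 0 < d g.
  rewrite /d.
  have ij : (j == i) = false by apply/eqP => /(congr1 (@nat_of_ord n)) /=; lia.
  have zi : (z == i) = false by apply/eqP => /(congr1 (@nat_of_ord n)) /=; lia.
  have pz : (p <= z)%N by rewrite /=; lia.
  have -> : splits (point_act (f_ p) g) = true.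
    apply/and3P; split.
    - rewrite !pg eqxx ij !block_last_coord.
      by apply: lt_trans (_ : 0 < _); rewrite ?oppr_lt0 ltr0n.
    - rewrite !pg ij zi !block_last_coord ltr_nat /=; lia.
    - apply/forallP => k; apply/implyP => pk; rewrite !pg zi ifF.
        rewrite !block_last_coord eqr_nat /=; lia.
      by apply/eqP => /(congr1 (@nat_of_ord n)) /=; lia.
  have f'z : f'_ p 0 z = 1 by rewrite block_first_coord ltnNge pz.
  have f'i : f'_ p 0 i = q.+2%:R.
    by rewrite block_first_coord ifT //=; lia.
  have f'j : f'_ p 0 j = q.+3%:R.
    by rewrite block_first_coord ifT //=; lia.
  have -> : splits (point_act (f'_ p) g) = false.
    apply/negP => /and3P[_]; rewrite !pg ij zi f'z f'j => h _; move: h.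
    by rewrite ltNge ler1n.
  have -> : splits (turn (point_act (f'_ p) g)) = false.
    apply/negP => /and3P[_]; rewrite !turn_coord tpermL tpermz // !pg eqxx zi f'z f'i.
    by rewrite opprK ltNge (le_trans (_ : -1 <= 0)) ?ler0n ?lerN10.
  by rewrite !subr0 ltr_pwDl.
rewrite (bigD1 g) //= ltr_pwDl //; exact: sumr_ge0.
Qed.

(** By [rank_step] the rank of [G] is at most that of [block_last q], so [G] has
    the ties of [point_act (block_last q) w]: one block of size [n - q] and
    singletons. Since the product of [G] with some face is that of
    [block_last p], the coordinates of [G] are positive and weakly increasing,
    constant from [p] on. The large block thus consists of the last [n - q]
    coordinates. *)
Lemma block_face_unique w G : is_face G ->
  (face_supp (face_of (point_act (f_ q) w)) <= face_supp G)%VS ->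
  \sum_F (face_mul G F == face_of (f_ p))%:R * block_diff p F != 0 ->
  G = face_of (f_ q).
Proof.
move=> fG sG nz; set r := point_act (f_ q) w in sG.
have rG : (face_rank G <= face_rank (face_of r))%N.
  rewrite leqNgt; apply: contraNN nz => lt; apply/eqP.
  apply: (rank_step (block_diff_radical B p) fG).
  apply: leq_ltn_trans (face_rank_block_last pq pn) _.
  by rewrite !ltnS -(face_rank_act B _ w).
have eG : face_supp G = face_supp (face_of r) by apply/esym/eqP; rewrite eqEdim sG.
have [c eGc] := fG.
have ker x y : (ext c x == ext c y) = (ext r x == ext r y).
  apply/eqP/eqP => e.
    have : r \in face_supp G by rewrite eG face_supp_self.
    by rewrite eGc => /face_supp_face_of; apply.
  have : c \in face_supp (face_of r) by rewrite -eG eGc face_supp_self.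
  by move=> /face_supp_face_of; apply.
have [F eF] : exists F, face_mul G F = face_of (f_ p).
  apply: contrapT => h; case/eqP: nz; rewrite big1 // => F _.
  by case: eqP => [e|_]; [case: h; exists F|rewrite mul0r].
have le x y : ext c x < ext c y -> ext (f_ p) x < ext (f_ p) y.
  by move=> lt; rewrite -in_face_of -eF eGc in_face_mul_face_of lt.
have [t [e [ti rt]]] := point_act_coord B w.
have rE k : r 0 k = (-1) ^+ e k * (minn (t k) q).+1%:R by rewrite rt block_last_coord.
have req k m : (r 0 k == r 0 m) = (e k == e m) && (minn (t k) q == minn (t m) q).
  rewrite !rE -eqSS -(eqr_nat rat).
  have h1 : 0 < (minn (t k) q).+1%:R :> rat by rewrite ltr0n.
  have h2 : 0 < (minn (t m) q).+1%:R :> rat by rewrite ltr0n.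
  by case: (e k); case: (e m); rewrite /= ?expr0 ?expr1 ?mulN1r ?mul1r ?eqr_opp //;
     apply/eqP; lra.
have extT v k : ext v (k, true) = - v 0 k by rewrite /ext /= expr1 mulN1r.
have extF v k : ext v (k, false) = v 0 k by rewrite /ext /= expr0 mul1r.
have ceq k m : (c 0 k == c 0 m) = (r 0 k == r 0 m) by rewrite -!extF ker.
have cpos k : 0 < c 0 k.
  have nz0 : c 0 k != - c 0 k.
    rewrite -extT -extF ker extF extT rE.
    have h1 : 0 < (minn (t k) q).+1%:R :> rat by rewrite ltr0n.
    by case: (e k); rewrite /= ?expr0 ?expr1 ?mulN1r ?mul1r; apply/eqP; lra.
  rewrite ltNge; apply/negP => c0.
  have lt : c 0 k < - c 0 k by rewrite lt_neqAle nz0; lra.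
  have := le (k, false) (k, true); rewrite !extF !extT => /(_ lt).
  by have := block_last_gt0 p k; lra.
have mono k m : (minn k p <= minn m p)%N -> c 0 k <= c 0 m.
  move=> km; rewrite leNgt; apply/negP => lt.
  have := le (m, false) (k, false); rewrite !extF => /(_ lt).
  by rewrite !block_last_coord ltr_nat ltnS ltnNge km.
have pz : (p <= z)%N by rewrite /=; lia.
have pz' : (p <= z')%N by rewrite /=; lia.
(* As before, [z] is in the large block because [z'] has the same value. *)
have tz : (q <= t z)%N.
  have : c 0 z == c 0 z'.
    by rewrite eq_le !mono //=; lia.
  rewrite ceq req => /andP[_ /eqP em]; rewrite leqNgt; apply/negP => lt.
  have et : t z = t z' by apply: ord_inj; lia.
  have := ti _ _ et => /(congr1 (@nat_of_ord n)) /=; lia.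
(* The large block of [r] may involve both signs, but [c] has the same ties as
   [r] and is positive, so that only one sign occurs. *)
have big k : (q <= t k)%N = (c 0 k == c 0 z).
  apply/idP/idP => [tk|]; last first.
    by rewrite ceq req (minn_idPr tz) => /andP[_ /eqP]; lia.
  rewrite ceq req (minn_idPr tz) (minn_idPr tk) eqxx andbT.
  apply: contraT => ne.
  have : c 0 k == - c 0 z.
    rewrite -extT -extF ker extF extT !rE (minn_idPr tz) (minn_idPr tk).
    by move: ne; case: (e k); case: (e z); rewrite //= ?expr0 ?expr1 ?mulN1r ?mul1r ?opprK.
  by move=> /eqP h; have := cpos k; have := cpos z; lra.
have upper k : (q <= t k)%N = (q <= k)%N.
  move: k; apply: perm_upper_set_closed => // k m km; rewrite !big => /eqP ek.
  rewrite eq_le mono; last by rewrite (minn_idPr pz); lia.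
  by rewrite -ek mono; lia.
rewrite eGc; apply: pos_face_eq => // [k|k m]; first exact: block_last_gt0.
rewrite !block_last_coord ltr_nat ltnS.
have eqc : (c 0 k == c 0 m) = (minn k q == minn m q :> nat).
  have [qk|kq] := leqP q k; have [qm|mq] := leqP q m.
  - have ek : c 0 k == c 0 z by rewrite -big upper.
    have em : c 0 m == c 0 z by rewrite -big upper.
    by rewrite (eqP ek) (eqP em) eqxx; apply/esym/eqP; lia.
  - have ek : c 0 k == c 0 z by rewrite -big upper.
    have em : (c 0 m == c 0 z) = false by rewrite -big upper leqNgt mq.
    by rewrite (eqP ek) eq_sym em; apply/esym/eqP; lia.
  - have ek : (c 0 k == c 0 z) = false by rewrite -big upper leqNgt kq.
    have em : c 0 m == c 0 z by rewrite -big upper.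
    by rewrite (eqP em) ek; apply/esym/eqP; lia.
  apply/idP/eqP => [|/ord_inj -> //]; rewrite ceq req => /andP[_ /eqP].
  have tk : (t k < q)%N by rewrite ltnNge upper -ltnNge.
  have tm : (t m < q)%N by rewrite ltnNge upper -ltnNge.
  rewrite (minn_idPl (ltnW tk)) (minn_idPl (ltnW tm)) => /ord_inj/ti -> //.
have [lt|] := ltnP (minn k q) (minn m q).
  rewrite lt_neqAle eqc mono; last by lia.
  by rewrite andbT; apply/eqP; lia.
rewrite leq_eqVlt => /orP[e1|lt].
  have /eqP -> : c 0 k == c 0 m by rewrite eqc eq_sym.
  by rewrite ltxx.
by apply/negbTE; rewrite -leNgt mono //; lia.
Qed.

End Coefficient.

(** * The lower bound *)

Section NonVanishing.
Variables (n : nat) (gT : finGroupType) (S : {set gT}) (B : typeB_action n S).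
Local Notation point_act := (point_act B).
Local Notation Psi := (Psi B).
Local Notation block_diff := (block_diff B).
Local Notation block_prod := (block_prod B).
Local Notation f_ := (@block_last n).
Local Notation f'_ := (@block_first n).
Local Notation J := (jacobson_radical (descent_algebra S)).

Lemma block_first_not_face w : (3 <= n)%N ->
  face_of (f_ 1) != face_of (point_act (f'_ 1) w).
Proof.
move=> n3; have [t [e [ti vt]]] := point_act_coord B w.
have lt0 : (0 < n)%N by lia.
have lt1 : (n.-1 < n)%N by lia.
have lt2 : (n.-2 < n)%N by lia.
pose o := Ordinal lt0; pose z := Ordinal lt1; pose z' := Ordinal lt2.
set v := point_act (f'_ 1) w.
have vE k : v 0 k = (-1) ^+ e k * (if (t k < 1)%N then 1%N else 0%N).+1%:R.
  by rewrite /v vt block_first_coord; case: ifP => // tk; congr (_ * _%:R); lia.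
apply/eqP => /setP h.
have cmp (b c : bool) k m := h ((k, b), (m, c)).
have := cmp true false o o; have := cmp false false o z.
have := cmp false false z z'; have := cmp false false z' z.
rewrite !in_face_of /ext /= !expr0 !mul1r !expr1 !mulN1r !block_last_coord !ltr_nat.
have -> : (minn n.-2 1 = 1)%N by lia.
have -> : (minn n.-1 1 = 1)%N by lia.
rewrite min0n ltnn ltnS ltn0Sn.
have -> : (- (1%:R : rat) < 1%:R) = true by [].
move=> /esym/negbT; rewrite -leNgt => h1 /esym/negbT; rewrite -leNgt => h2.
move=> /esym lt /esym pos.
have zz : v 0 z = v 0 z' by apply/eqP; rewrite eq_le h1 h2.
have tz : (t z < 1)%N = false.
  apply/negP => tz; move: zz; rewrite !vE tz; case: ifP => [tz'|_].
    have := ti z z' (ord_inj (_ : t z = t z' :> nat)); move=> hz.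
    have /(congr1 (@nat_of_ord n)) /= := hz ltac:(lia); lia.
  by case: (e z); case: (e z'); rewrite /= ?expr0 ?expr1 => hh; lra.
move: lt pos; rewrite !vE tz; case: ifP => _;
  by case: (e o); case: (e z); rewrite /= ?expr0 ?expr1 => *; lra.
Qed.

(** Induction on the number of factors: by [block_face_unique] only the face of
    [block_last q] contributes to the coefficient, with the factor of
    [block_inner_gt0]. For a single factor, a block of the value 1 cannot be
    outermost, which excludes the orbit of [block_first 1]. *)
Lemma block_prod_coef j : ((j.*2.+1).+2 <= n)%N ->
  block_prod j.+1 (face_of (f_ j.*2.+1)) != 0.
Proof.
elim: j => [|j IH] jn.
  rewrite /= conv1 block_diffE; apply: lt0r_neq0.
  under eq_bigr => w _ do rewrite (negbTE (block_first_not_face w jn)) subr0.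
  rewrite (bigD1 1%g) //= point_act1 eqxx ltr_pwDl //; apply: sumr_ge0 => w _.
  exact: ler0n.
set q := j.*2.+1 in IH *; set p := (j.+1).*2.+1.
have pq : p = q.+2 by [].
have pn : (p.+2 <= n)%N by [].
rewrite [block_prod _]/(conv (block_prod j.+1) (block_diff p)) /conv.
have inner G : \sum_(F | face_mul G F == face_of (f_ p)) block_prod j.+1 G * block_diff p F =
   block_prod j.+1 G * \sum_F (face_mul G F == face_of (f_ p))%:R * block_diff p F.
  rewrite mulr_sumr big_mkcond; apply: eq_bigr => F _.
  by case: (_ == _); rewrite ?mul1r // mul0r mulr0.
under eq_bigr => G _ do rewrite inner.
rewrite (bigD1 (face_of (f_ q))) //= [X in _ + X]big1 ?addr0.
  apply: mulf_neq0; first by apply: IH; rewrite /q in pq *; lia.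
  exact: lt0r_neq0 (block_inner_gt0 B pq pn).
move=> G nG; apply/eqP; rewrite mulf_eq0; apply/orP.
have [_|bG] := eqVneq (conv (block_prod j) (block_diff q) G) 0; [by left|right].
apply: contraNT nG => nz.
have fG : is_face G by have [_] := block_prod_invariant B j.+1; apply.
have [G' [F [eG aF]]] : exists G' F, face_mul G' F = G /\ block_diff q F != 0.
  apply: contrapT => h; case/eqP: bG; rewrite /conv big1 // => G' _.
  rewrite big1 // => F /eqP eG; apply/eqP; rewrite mulf_eq0; apply/orP; right.
  by apply: contraT => aF; case: h; exists G', F.
have [w eF] := block_diff_neq0 aF.
apply/eqP; apply: (block_face_unique pq pn (w := w) fG _ nz).
rewrite -eG; apply: subv_trans (face_supp_face_mulr G' F).
case: eF => ->; first exact: subvv.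
apply: face_supp_le => x y /eqP; rewrite point_act_block_kernel => /eqP //.
Qed.

Lemma Psi_block_prod k : Psi (block_prod k.+1) \in (J ^+ k.+1)%VS.
Proof.
have aJ p : Psi (block_diff p) \in J.
  rewrite (descent_radical B); apply/mem_rank_space; exists (block_diff p) => //.
  exact: block_diff_radical.
elim: k => [|k IH]; first by rewrite /= conv1 expv1.
rewrite expvSl [block_prod _]/(conv (block_prod k.+1) (block_diff (k.+1).*2.+1)).
rewrite Psi_conv ?memv_mul //; exact: (block_diff_radical B _).1.
Qed.

Lemma radical_exp_neq0 k : (k.+1.*2 < n)%N -> (J ^+ k.+1 != 0)%VS.
Proof.
move=> kn; apply: contraTneq (Psi_block_prod k) => ->; rewrite memv0.
apply/eqP => P0; have := block_prod_coef (j := k).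
rewrite (Psi_faithful (block_prod_invariant B k.+1) P0) eqxx => /(_ _)/negP; apply=> //.
Qed.

End NonVanishing.

Theorem proposition5p5 (n : nat) (hn : (1 <= n)%N)
    (gT : finGroupType) (S : {set gT}) :
  coxeter_system S -> type_B n S ->
  loewy_length (descent_algebra S) = uphalf n.
Proof.
move=> cS tS; have [B] := typeB_actionP cS tS.
apply: leastE.
  rewrite (radical_exp0 B) ?eqxx ?andbT //; lia.
move=> [|k] /andP[// _ J0]; rewrite leqNgt; apply: contraTN J0 => lt.
by apply: (radical_exp_neq0 B); lia.
Qed.
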